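(* Let $G$ be a maximal planar graph on $n\ge 3$ vertices whose maximum degree is $d$. Then $G$ has a plane-saturated subgraph with at most $$3n-6-\min(d,\,n-d-1)$$ edges. Moreover, if $n\ge 75$ and $d\ge 0.933n$, then $G$ has a plane-saturated subgraph with at most $$\left(3-\frac{d^2}{12n^2+dn}\right)n+1$$ edges.
   Context: All graphs are finite and simple. A plane graph is a planar graph together with a specific plane embedding: vertices are mapped to distinct points of $\mathbb{R}^2$ and edges to simple topological curves joining their endpoints, where no two curves intersect, overlap or touch except possibly at common endpoints. A maximal planar graph on $n\ge 3$ vertices is a planar graph to which no edge can be added while keeping it simple and planar; it has $3n-6$ edges. Plane-saturated subgraph (unlabeled): a plane graph $H$ is a plane-saturated subgraph of $G$ if $H$ is (isomorphic to) a subgraph of $G$ with the same number of vertices as $G$, and adding any edge (between two non-adjacent vertices of $H$) to the drawing of $H$ either introduces a crossing or results in a graph that is no longer (isomorphic to) a subgraph of $G$. The embedding of $H$ is arbitrary and need not extend to an embedding of $G$. *)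

(* Defs.v *)
From HB Require Import structures.
From mathcomp Require Import all_boot all_order all_algebra.
From mathcomp Require Import all_classical all_reals all_analysis.
Import Order.TTheory GRing.Theory Num.Theory numFieldNormedType.Exports.

Set Implicit Arguments.
Unset Strict Implicit.
Unset Printing Implicit Defensive.

Local Open Scope classical_set_scope.
Local Open Scope ring_scope.

Record sgraph (V : finType) := SGraph {
  adj :> rel V;
  adj_sym : symmetric adj;
  adj_irr : irreflexive adj }.

Definition edges (V : finType) (G : sgraph V) : {set {set V}} :=
  [set [set p.1; p.2]%SET | p : V * V & G p.1 p.2]%SET.

Definition num_edges (V : finType) (G : sgraph V) : nat := #|edges G|.

Definition degree (V : finType) (G : sgraph V) (x : V) : nat :=
  #|[set y | G x y]%SET|.

Definition max_degree (V : finType) (G : sgraph V) : nat :=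
  \max_(x : V) degree G x.

(* The guard [x != y] makes [add_edge] total: adding a loop has no effect. *)
Definition add_edge_rel (V : finType) (G : sgraph V) (u v : V) : rel V :=
  fun x y => G x y || (x != y) && ([set x; y] == [set u; v])%SET.

Lemma add_edge_sym (V : finType) (G : sgraph V) (u v : V) :
  symmetric (add_edge_rel G u v).
Proof.
by move=> x y; rewrite /add_edge_rel adj_sym eq_sym finset.setUC.
Qed.

Lemma add_edge_irr (V : finType) (G : sgraph V) (u v : V) :
  irreflexive (add_edge_rel G u v).
Proof. by move=> x; rewrite /add_edge_rel adj_irr eqxx. Qed.

Definition add_edge (V : finType) (G : sgraph V) (u v : V) : sgraph V :=
  SGraph (add_edge_sym G u v) (add_edge_irr G u v).

Definition iso_to_subgraph (W V : finType) (H : sgraph W) (G : sgraph V) : Prop :=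
  exists2 f : W -> V, injective f & forall x y, H x y -> G (f x) (f y).

(* [A] is the image of a simple curve from [p] to [q]. *)
Definition is_arc (R : realType) (p q : R * R) (A : set (R * R)) : Prop :=
  exists g : R -> R * R,
    [/\ {within `[0, 1], continuous g},
        {in `[0, 1] &, injective g},
        g 0 = p, g 1 = q & A = g @` `[0, 1]].

(* Curves are represented by their images and indexed by unordered pairs of
   vertices; the value of [arc] outside [edges G] is irrelevant.
   [pd_vertex] keeps curves away from vertices that are not their endpoints; it
   follows from [pd_cross] except for isolated vertices. *)
Record plane_drawing (R : realType) (V : finType) (G : sgraph V)
    (pt : V -> R * R) (arc : {set V} -> set (R * R)) : Prop := PlaneDrawing {
  pd_inj : injective pt;
  pd_arc : forall u v, G u v -> is_arc (pt u) (pt v) (arc [set u; v]%SET);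
  pd_vertex : forall e w, e \in edges G -> arc e (pt w) -> w \in e;
  pd_cross : forall e f, e \in edges G -> f \in edges G -> e != f ->
    forall z, arc e z -> arc f z ->
    exists w, [/\ w \in e, w \in f & z = pt w] }.

Definition planar (R : realType) (V : finType) (G : sgraph V) : Prop :=
  exists (pt : V -> R * R) (arc : {set V} -> set (R * R)),
    plane_drawing G pt arc.

Definition maximal_planar (R : realType) (V : finType) (G : sgraph V) : Prop :=
  planar R G /\
  forall u v, u != v -> ~~ G u v -> ~ planar R (add_edge G u v).

Record plane_graph (R : realType) (V : finType) := PlaneGraph {
  pg_graph :> sgraph V;
  pg_pt : V -> R * R;
  pg_arc : {set V} -> set (R * R);
  pg_drawing : plane_drawing pg_graph pg_pt pg_arc }.

(* The drawing of [H] is kept fixed and only the curve [A] of the new edge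
   varies. *)
Definition plane_saturated_subgraph (R : realType) (W V : finType)
    (H : plane_graph R W) (G : sgraph V) : Prop :=
  [/\ #|W| = #|V|,
      iso_to_subgraph H G &
      forall (u v : W) (A : set (R * R)), u != v -> ~~ H u v ->
        plane_drawing (add_edge H u v) (pg_pt H)
          (fun e => if e == [set u; v]%SET then A else pg_arc H e) ->
        ~ iso_to_subgraph (add_edge H u v) G].

(* Main.v *)
(* The vertices are placed on a fixed straight-line drawing, a subgraph of G is
   drawn there and saturated greedily; the edges that G has but the saturated
   drawing H cannot have are then counted.  The hubs of the drawing have so many
   neighbours that every embedding of H into G maps hubs to hubs.

   First bound.  A vertex x of maximum degree d is the centre of a wheel whose rim
   lists its neighbours; x and the cyclic order are chosen to maximize the number
   p of rim pairs adjacent in G, and those rim edges are drawn.  Each of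
   min(p, n - d - 1) vertices not adjacent to x is locked in its own triangle
   formed by x and a rim edge, so it has degree at most 2 in H.  By extremality no
   embedding of H into G lets a missing rim pair become adjacent, yet these d - p
   pairs can all be joined close to x without spoiling planarity.  Hence H misses
   (d - p) + min(p, n - d - 1) of the 3n - 6 possible edges.

   Second bound.  Let k be about d^2/(12n+d), so that 13k <= d.  The first bound
   suffices if k <= n - d - 1, and any H does if G has few edges.  Otherwise d is
   nearly n, G is nearly a triangulation, and there are two cases.  If all other
   degrees are below d - 2k, a cycle avoiding x separates x from 2k vertices,
   which cannot be joined to x any more.  Otherwise there is a second hub y; a triangle
   through x separates y from 4k + 3 common neighbours of x and y.

   The bound 3n - 6 is needed for drawings in which only edges without common
   endpoint are disjoint.  Such drawings survive edge contraction, and after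
   replacing arcs by polygonal paths the parity of crossings excludes K5 and K33;
   an argument of Mader then gives the bound. *)
Require Import Defs.
From HB Require Import structures.
From mathcomp Require Import all_boot all_order all_algebra.
From mathcomp Require Import all_classical all_reals all_analysis.
From mathcomp Require Import zify ring lra.
From Stdlib Require Import Btauto.
Import Order.TTheory GRing.Theory Num.Theory numFieldNormedType.Exports.
Set Implicit Arguments.
Unset Strict Implicit.
Unset Printing Implicit Defensive.
Local Open Scope classical_set_scope.
Local Open Scope ring_scope.

(** * Crossing parity of polygonal paths *)

(** Greedy saturation gives no control over the edges that it adds, nor over the embedding of [H]
    into [G], which need not respect the drawing. Away from the hubs, [H] can be compared with [G]
    only once the embedding is known to preserve the set of hubs.

    The constant 13 comes from the case of two hubs. All but [4k] vertices are common neighbours of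
    the hubs. If these were pairwise non-adjacent, the at most [4k] other vertices would carry fewer
    than [12k] edges among themselves and at most [2n] further edges would exist, whereas [G] has at
    least [3n - 5 - k]. The value [d^2/(12n+d)] is at most [d/13] because [d <= n].

    Edges are drawn as compact sets containing arbitrarily fine chains, because contraction turns
    arcs into unions of arcs, which need not be arcs any more. *)

Section Parity.
Variable R : realFieldType.
Implicit Types (p q a b c : R * R) (s t : seq (R * R)).

(** Twice the signed area of the triangle [p q a]: positive when [a] lies to the left of the line
    from [p] to [q]. *)
Definition orient p q a : R :=
  (q.1 - p.1) * (a.2 - p.2) - (q.2 - p.2) * (a.1 - p.1).

Definition segments_disjoint p q a b : Prop := forall x y : R,
  0 <= x <= 1 -> 0 <= y <= 1 ->
  p.1 + x * (q.1 - p.1) = a.1 + y * (b.1 - a.1) ->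
  p.2 + x * (q.2 - p.2) = a.2 + y * (b.2 - a.2) -> False.

(** The test asks whether the upward vertical ray from [a] meets the segment in a point other than
    [a]. The range of abscissae is half-open, so vertical segments never count. *)
Definition below a p q : bool :=
  ((p.1 < a.1) (+) (q.1 < a.1)) &&
  (if p.1 < q.1 then orient p q a < 0 else orient q p a < 0).

Lemma below_swap a p q : p.1 != q.1 -> below a p q = below a q p.
Proof.
by rewrite /below addbC; case: (ltgtP p.1 q.1).
Qed.

Lemma below_vertical a p q : p.1 = q.1 -> below a p q = false.
Proof. by move=> e; rewrite /below e addbb. Qed.

Lemma segments_disjoint_sym p q a b :
  segments_disjoint p q a b -> segments_disjoint a b p q.
Proof. by move=> h x y hx hy e1 e2; apply: (h y x). Qed.

Lemma segments_disjoint_swap p q a b :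
  segments_disjoint p q a b -> segments_disjoint q p a b.
Proof.
move=> h x y hx hy e1 e2; apply: (h (1 - x) y) => //; first by lra.
  by rewrite -e1; ring.
by rewrite -e2; ring.
Qed.

(** Extend both segments by upward vertical rays at their ends. The two resulting curves cross an
    odd number of times exactly if their ends interleave. The [below] terms count the crossings of a
    ray with a segment and the comparisons detect interleaving; what is left is the parity of
    crossings of the segments themselves. *)
Definition crossing_parity p q a b : bool :=
  below a p q (+) below b p q (+) (below p a b (+) below q a b) (+)
  ((a.1 < p.1) (+) (b.1 < p.1) (+) ((a.1 < q.1) (+) (b.1 < q.1))).

(** The function [orient p q] is affine along [a b] and changes sign, so it vanishes at the
    parameter [y] below. That zero lies on the segment [p q] because its abscissa is between [p.1]
    and [q.1]. *)
Lemma same_side p q a b : p.1 < a.1 -> a.1 < q.1 -> p.1 < b.1 -> b.1 < q.1 ->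
  segments_disjoint p q a b -> orient p q a < 0 -> 0 <= orient p q b -> False.
Proof.
move=> pa aq pb bq dis oa ob.
pose y := orient p q a / (orient p q a - orient p q b).
have dneg : orient p q a - orient p q b < 0 by lra.
have yE : y * (orient p q a - orient p q b) = orient p q a.
  by rewrite /y divfK // lt_eqF.
have y01 : 0 <= y <= 1.
  apply/andP; split; first by rewrite /y ler_ndivlMr // mul0r ltW.
  by rewrite /y ler_ndivrMr // mul1r; lra.
pose zx := a.1 + y * (b.1 - a.1).
pose zy := a.2 + y * (b.2 - a.2).
have zxp : p.1 < zx < q.1.
  have -> : zx = (1 - y) * a.1 + y * b.1 by rewrite /zx; ring.
  by apply/andP; split; nra.
have qp : 0 < q.1 - p.1 by lra.
pose x := (zx - p.1) / (q.1 - p.1).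
have xE : x * (q.1 - p.1) = zx - p.1 by rewrite /x divfK // gt_eqF.
have x01 : 0 <= x <= 1.
  apply/andP; split; first by rewrite /x ler_pdivlMr // mul0r; lra.
  by rewrite /x ler_pdivrMr // mul1r; lra.
apply: (dis x y x01 y01); first by rewrite xE /zx; ring.
have oz : (q.1 - p.1) * (zy - p.2) - (q.2 - p.2) * (zx - p.1) = 0.
  have -> : (q.1 - p.1) * (zy - p.2) - (q.2 - p.2) * (zx - p.1) =
    orient p q a - y * (orient p q a - orient p q b).
    by rewrite /zx /zy /orient; ring.
  by rewrite yE subrr.
apply: (mulfI (negbT (gt_eqF qp))).
have -> : (q.1 - p.1) * (p.2 + x * (q.2 - p.2)) =
  (q.1 - p.1) * p.2 + (x * (q.1 - p.1)) * (q.2 - p.2) by ring.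
rewrite xE -/zy.
clear -oz; clearbody zx zy; lra.
Qed.

Lemma clear_denominator (x y z k : R) : k != 0 ->
  (x + y / k * z) * k = x * k + y * z.
Proof. by move=> k0; field. Qed.

Lemma clear_denominator_D (x y z k : R) : k != 0 ->
  (x + (1 + y / k) * z) * k = x * k + (k + y) * z.
Proof. by move=> k0; field. Qed.

(** By Cramer's rule the lines meet at the parameters [1 + o2 / k] and [- o1 / k], where [k] is the
    determinant of the directions. If the equality failed, [o1] and [o2] would be both nonpositive
    or both nonnegative, and [key] would put both parameters in the unit interval. *)
Lemma interleaved p q a b : p.1 < a.1 -> a.1 < q.1 -> q.1 < b.1 ->
  segments_disjoint p q a b ->
  (orient p q a < 0) = (0 < orient a b q).
Proof.
move=> pa aq qb dis.
set o1 := orient p q a; set o2 := orient a b q.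
pose k := (q.1 - p.1) * (b.2 - a.2) - (q.2 - p.2) * (b.1 - a.1).
have key : (q.1 - a.1) * k = - (q.1 - p.1) * o2 - (b.1 - a.1) * o1.
  by rewrite /k /o1 /o2 /orient; ring.
have meet : k != 0 -> 0 <= - o1 / k <= 1 -> 0 <= 1 + o2 / k <= 1 -> False.
  move=> k0 h1 h2; apply: (dis _ _ h2 h1).
    apply: (mulIf k0); rewrite clear_denominator_D // clear_denominator //.
    by rewrite /o1 /o2 /k /orient; ring.
  apply: (mulIf k0); rewrite clear_denominator_D // clear_denominator //.
  by rewrite /o1 /o2 /k /orient; ring.
have [neg1|pos1] := ltP o1 0; have [pos2|neg2] := ltP 0 o2 => //; exfalso.
- have kge : - o1 - o2 <= k.
    have : 0 <= (q.1 - a.1) * (k + o1 + o2).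
      have -> : (q.1 - a.1) * (k + o1 + o2) =
        (q.1 - a.1) * k + (q.1 - a.1) * o1 + (q.1 - a.1) * o2 by ring.
      by rewrite key; nra.
    by rewrite pmulr_rge0; lra.
  have k0 : 0 < k by lra.
  apply: meet; first by rewrite gt_eqF.
    by rewrite ler_pdivlMr // ler_pdivrMr // mul0r mul1r; lra.
  have : -1 <= o2 / k <= 0 by rewrite ler_pdivlMr // ler_pdivrMr //; lra.
  lra.
- have kle : k <= - o1 - o2.
    have : (q.1 - a.1) * (k + o1 + o2) <= 0.
      have -> : (q.1 - a.1) * (k + o1 + o2) =
        (q.1 - a.1) * k + (q.1 - a.1) * o1 + (q.1 - a.1) * o2 by ring.
      by rewrite key; nra.
    by rewrite pmulr_rle0; lra.
  have [k0|k0] := eqVneq k 0; last first.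
    have {}k0 : k < 0 by lra.
    apply: meet; first by rewrite lt_eqF.
      by rewrite ler_ndivlMr // ler_ndivrMr // mul0r mul1r; lra.
    have : -1 <= o2 / k <= 0 by rewrite ler_ndivlMr // ler_ndivrMr //; lra.
    lra.
  have o10 : o1 = 0 by lra.
  have qp : 0 < q.1 - p.1 by lra.
  pose x := (a.1 - p.1) / (q.1 - p.1).
  have xE : x * (q.1 - p.1) = a.1 - p.1 by rewrite /x divfK // gt_eqF.
  apply: (dis x 0).
  + by rewrite /x ler_pdivlMr // ler_pdivrMr // mul0r mul1r; lra.
  + by rewrite lexx ler01.
  + by rewrite xE; ring.
  apply: (mulfI (negbT (gt_eqF qp))).
  have -> : (q.1 - p.1) * (p.2 + x * (q.2 - p.2)) =
    (q.1 - p.1) * p.2 + (x * (q.1 - p.1)) * (q.2 - p.2) by ring.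
  by rewrite xE mul0r addr0; move: o10; rewrite /o1 /orient; lra.
Qed.

Definition distinct_abscissae p q a b :=
  [&& p.1 != a.1, p.1 != b.1, q.1 != a.1 & q.1 != b.1].

(** Swapping the ends of a segment or the two segments preserves the parity, so [p] may be assumed
    leftmost. This leaves separated, interleaved and nested ranges of abscissae. *)
Lemma crossing_parity_disjoint p q a b : distinct_abscissae p q a b ->
  segments_disjoint p q a b -> crossing_parity p q a b = false.
Proof.
have swap1 p' q' a' b' : crossing_parity p' q' a' b' = crossing_parity q' p' a' b'.
  have [e|ne] := eqVneq p'.1 q'.1.
    by rewrite /crossing_parity !(below_vertical _ e) !(below_vertical _ (esym e)) e
      !addbb [below p' _ _ (+) _]addbC.
  rewrite /crossing_parity !(below_swap _ ne) [below p' _ _ (+) _]addbC.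
  by congr (_ (+) _); rewrite addbC.
have swap2 p' q' a' b' : distinct_abscissae p' q' a' b' ->
    crossing_parity p' q' a' b' = crossing_parity a' b' p' q'.
  case/and4P=> n1 n2 n3 n4; rewrite /crossing_parity.
  have neg (u v : R) : u != v -> (u < v) = ~~ (v < u) by case: ltgtP.
  rewrite (neg p'.1 _ n1) (neg p'.1 _ n2) (neg q'.1 _ n3) (neg q'.1 _ n4).
  move: (below a' p' q') (below b' p' q') (below p' a' b') (below q' a' b').
  move: (a'.1 < p'.1) (b'.1 < p'.1) (a'.1 < q'.1) (b'.1 < q'.1).
  by do 8![case].
have dswap p' q' a' b' : distinct_abscissae p' q' a' b' -> distinct_abscissae q' p' a' b'.
  by case/and4P=> *; apply/and4P; split.
have dsym p' q' a' b' : distinct_abscissae p' q' a' b' -> distinct_abscissae a' b' p' q'.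
  by case/and4P=> *; apply/and4P; split; rewrite eq_sym.
wlog pq : p q / p.1 <= q.1.
  move=> W; have [/W//|/ltW qp] := lerP p.1 q.1.
  by move=> /dswap d /segments_disjoint_swap h; rewrite swap1; apply: W.
wlog ab : p q a b pq / a.1 <= b.1.
  move=> W; have [ab|/ltW ba] := lerP a.1 b.1; first exact: W.
  move=> d h; rewrite swap2 // swap1 -swap2; last exact/dsym/dswap/dsym.
  by apply: W => //; [exact/dsym/dswap/dsym|
    exact/segments_disjoint_sym/segments_disjoint_swap/segments_disjoint_sym].
wlog pa : p q a b pq ab / p.1 < a.1.
  move=> W d h; have [pa|ap] := ltP p.1 a.1; first exact: W.
  rewrite swap2 //; apply: W => //; [|exact: dsym|exact: segments_disjoint_sym].
  by case/and4P: d => n1 _ _ _; rewrite lt_neqAle eq_sym n1.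
case/and4P=> n1 n2 n3 n4 dis.
have xlt (u v : R) : v < u -> (u < v) = false by move=> h; rewrite ltNge (ltW h).
have pb : p.1 < b.1 by lra.
have [qa|aq] := ltP q.1 a.1.
  have qb : q.1 < b.1 by lra.
  by rewrite /crossing_parity /below !(xlt _ _ pa) !(xlt _ _ pb) !(xlt _ _ qa)
    !(xlt _ _ qb) pa pb qa qb.
have {}aq : a.1 < q.1 by rewrite lt_neqAle eq_sym n3.
have [qb|bq] := ltP q.1 b.1.
  have ab' : a.1 < b.1 by lra.
  have pq' : p.1 < q.1 by lra.
  rewrite /crossing_parity /below pq' ab' pa (xlt _ _ pa) pb (xlt _ _ pb) aq
    (xlt _ _ aq) qb (xlt _ _ qb) /= (interleaved pa aq qb dis).
  (* Both [below] terms are strict, so the case in which [q] lies on [a b] remains; there the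
     segments meet. *)
  case: (ltgtP (orient a b q) 0) => // o0; exfalso.
  have := interleaved pa aq qb dis; rewrite o0 ltxx => /negbT; rewrite -leNgt => o1.
  have dba : 0 < b.1 - a.1 by lra.
  pose y := (q.1 - a.1) / (b.1 - a.1).
  have yE : y * (b.1 - a.1) = q.1 - a.1 by rewrite /y divfK // gt_eqF.
  apply: (dis 1 y); first by rewrite ler01 lexx.
  - by rewrite /y ler_pdivlMr // ler_pdivrMr // mul0r mul1r; lra.
  - by rewrite yE; ring.
  apply: (mulfI (negbT (gt_eqF dba))).
  have -> : (b.1 - a.1) * (a.2 + y * (b.2 - a.2)) =
    (b.1 - a.1) * a.2 + (y * (b.1 - a.1)) * (b.2 - a.2) by ring.
  by rewrite yE; move: o0; rewrite /orient; lra.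
have {}bq : b.1 < q.1 by rewrite lt_neqAle eq_sym n4.
have pq' : p.1 < q.1 by lra.
rewrite /crossing_parity /below pq' pa (xlt _ _ pa) pb (xlt _ _ pb) aq
  (xlt _ _ aq) bq (xlt _ _ bq) /=.
case: (ltP (orient p q a) 0) => o1; case: (ltP (orient p q b) 0) => o2 //; exfalso.
  exact: (same_side pa aq pb bq dis o1 o2).
apply: (same_side pb bq pa aq _ o2 o1).
exact/segments_disjoint_sym/segments_disjoint_swap/segments_disjoint_sym.
Qed.

Fixpoint path_below c p s : bool :=
  if s is q :: s' then below c p q (+) path_below c q s' else false.

Fixpoint segment_path_disjoint p q a t : Prop :=
  if t is b :: t' then
    [/\ distinct_abscissae p q a b, segments_disjoint p q a b &
        segment_path_disjoint p q b t']
  else True.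

Fixpoint paths_disjoint p s a t : Prop :=
  if s is q :: s' then segment_path_disjoint p q a t /\ paths_disjoint q s' a t
  else True.

Lemma addb_xorb (x y : bool) : x (+) y = xorb x y. Proof. by case: x. Qed.

Lemma addb_eqF (x y z : bool) : x = false -> y = false -> z = x (+) y -> z = false.
Proof. by move=> -> -> ->. Qed.

(** In the sum of the parities over the path, every inner vertex occurs in two consecutive summands
    and cancels; only the ends remain. *)
Lemma segment_path_parity p q a t : segment_path_disjoint p q a t ->
  below a p q (+) below (last a t) p q (+)
    (path_below p a t (+) path_below q a t) (+)
  ((a.1 < p.1) (+) ((last a t).1 < p.1) (+)
    ((a.1 < q.1) (+) ((last a t).1 < q.1))) = false.
Proof.
elim: t a => [|b t IH] a /=; first by rewrite !addbb.
case=> d dis /IH /(addb_eqF (crossing_parity_disjoint d dis)); apply.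
rewrite /crossing_parity !addb_xorb; btauto.
Qed.

Lemma paths_parity p s a t : paths_disjoint p s a t ->
  path_below a p s (+) path_below (last a t) p s (+)
    (path_below p a t (+) path_below (last p s) a t) (+)
  ((a.1 < p.1) (+) ((last a t).1 < p.1) (+)
    ((a.1 < (last p s).1) (+) ((last a t).1 < (last p s).1))) = false.
Proof.
elim: s p => [|q s IH] p /=; first by rewrite !addbb.
case=> /segment_path_parity h /IH /(addb_eqF h); apply; rewrite !addb_xorb; btauto.
Qed.

End Parity.

(** * Chaining and separation of arcs *)

Section Chains.
Variable R : realType.
Implicit Types (K L : set (R * R)) (p q a b : R * R) (d : R).

Definition close d : rel (R * R) :=
  fun a b => (`|a.1 - b.1| < d) && (`|a.2 - b.2| < d).

(** A substitute for an arc from [p] to [q] in [K]: it survives unions, and a fine chain is already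
    the vertex list of a polygonal path near [K]. *)
Definition chained K p q : Prop := forall d, 0 < d ->
  exists s, [/\ path (close d) p s, last p s = q & {in p :: s, forall z, K z}].

Lemma chained_trans K p q a : chained K p q -> chained K q a -> chained K p a.
Proof.
move=> h1 h2 d d0; have [s [ps ls ins]] := h1 d d0.
have [t [pt lt int]] := h2 d d0.
exists (s ++ t); split; first by rewrite cat_path ps ls.
  by rewrite last_cat ls.
move=> z; rewrite -cat_cons mem_cat => /orP[/ins//|zt].
by apply: int; rewrite inE zt orbT.
Qed.

Lemma chained_sub K L p q : K `<=` L -> chained K p q -> chained L p q.
Proof.
move=> KL h d d0; have [s [ps ls ins]] := h d d0.
by exists s; split => // z /ins /KL.
Qed.

Lemma close_split d a b c : close (d / 2) a b -> close (d / 2) b c -> close d a c.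
Proof.
case/andP=> h1 h2 /andP[h3 h4]; apply/andP; split.
  by rewrite (le_lt_trans (ler_distD b.1 _ _)) //; lra.
by rewrite (le_lt_trans (ler_distD b.2 _ _)) //; lra.
Qed.

Lemma closeC d a b : close d a b = close d b a.
Proof. by rewrite /close distrC [X in _ && (X < _)]distrC. Qed.

Lemma near_close d a : 0 < d -> \forall x \near a, close d a x.
Proof.
move=> d0; have := nbhsx_ballx a _ d0.
by apply: filterS => -[x y] [] /=; rewrite /ball /= => h1 h2; apply/andP.
Qed.

(** A third of the distance of two points still separates all points near them; compactness of the
    product makes the radius uniform. *)
Lemma compact_separated K L : compact K -> compact L -> K `&` L = set0 ->
  exists2 d, 0 < d & forall a b, K a -> L b -> ~~ close d a b.
Proof.
move=> cK cL KL.
have /compact_near_coveringP cKL := compact_setX cK cL.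
have := cKL _ (0^'+ : set_system R) (fun d ab => ~~ close d ab.1 ab.2) _.
case.
- move=> [a b] [/= Ka Lb].
  pose e := Num.max `|a.1 - b.1| `|a.2 - b.2|.
  have e0 : 0 < e.
    rewrite lt_max !normr_gt0 !subr_eq0 -negb_and; apply/negP => /andP[/eqP h1 /eqP h2].
    suff : (K `&` L) a by rewrite KL.
    by split => //; rewrite [a]surjective_pairing h1 h2 -surjective_pairing.
  have e3 : 0 < e / 3 by lra.
  exists ([set x | close (e / 3) a x.1 /\ close (e / 3) b x.2], [set i | i < e / 3]).
    split; last exact: nbhs_right_lt.
    have : nbhs (a, b) ([set x | close (e / 3) a x] `*` [set x | close (e / 3) b x]).
      by exists ([set x | close (e / 3) a x], [set x | close (e / 3) b x]) => //; split;
        exact: near_close.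
    exact: filterS.
  move=> [[x y] i] [[]] /andP[/= h1 h2] /andP[h3 h4] i3; apply/negP => /andP[/= h5 h6].
  have : e <= `|a.1 - b.1| \/ e <= `|a.2 - b.2|.
    by apply/orP; rewrite -le_max.
  have t1 := ler_distD x.1 a.1 b.1; have t2 := ler_distD y.1 x.1 b.1.
  have t3 := ler_distD x.2 a.2 b.2; have t4 := ler_distD y.2 x.2 b.2.
  rewrite distrC in h3; rewrite distrC in h4.
  by case; lra.
- move=> d' /= d'0 h.
  exists (d' / 2); first by rewrite divr_gt0.
  move=> a b Ka Lb; apply: (h (d' / 2) _ _ (a, b)) => //=.
    by rewrite sub0r normrN gtr0_norm; lra.
  by lra.
Qed.

Lemma arc_compact p q K : is_arc p q K -> compact K.
Proof.
case=> g [cg _ _ _ ->]; apply: continuous_compact => //; exact: segment_compact.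
Qed.

(** Compactness gives uniform continuity, and the images of an equidistant subdivision then form the
    chain. *)
Lemma path_chained (g : R -> R * R) : {within `[0, 1], continuous g} ->
  chained (g @` `[0, 1]) (g 0) (g 1).
Proof.
move=> cg d d0.
have /compact_near_coveringP cI := @segment_compact R 0 1.
have := cI _ (0^'+ : set_system R)
  (fun e t => 0 <= t <= 1 -> forall u, 0 <= u <= 1 ->
    `|t - u| < e -> close d (g t) (g u)) _.
case.
- move=> t It.
  have d2 : 0 < d / 2 by lra.
  have /subspace_continuousP/(_ t It) ct := cg.
  have /ct : nbhs (g t) [set x | close (d / 2) (g t) x] by exact: near_close.
  case => r /= r0 hr.
  exists ([set x | `|t - x| < r / 2], [set e | e < r / 2]).
    split; last by apply: nbhs_right_lt; rewrite divr_gt0.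
    by apply: nbhsx_ballx; rewrite divr_gt0.
  move=> [t' e] /= [h1 h2] It' u Iu tu.
  have e1 : close (d / 2) (g t) (g t').
    by apply: hr => /=; rewrite ?in_itv //= (lt_trans h1) //; lra.
  have e2 : close (d / 2) (g t) (g u).
    apply: hr => /=; rewrite ?in_itv //=.
    by rewrite (le_lt_trans (ler_distD t' _ _)) //; lra.
  by apply: close_split e2; rewrite closeC.
move=> e /= e0 h.
have {h} h t u : 0 <= t <= 1 -> 0 <= u <= 1 ->
  `|t - u| < e / 2 -> close d (g t) (g u).
  move=> t01 u01; apply: (h (e / 2)) => //=; rewrite ?in_itv //=.
    by rewrite sub0r normrN gtr0_norm; lra.
  by lra.
have [N hN] : exists N : nat, (2 / e) < N.+1%:R.
  exists (Num.truncn (2 / e)); exact: truncnS_gt.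
have N0 : 0 < N.+1%:R :> R by rewrite ltr0n.
have Ne : N.+1%:R^-1 < e / 2 by rewrite -[e / 2]invf_div ltf_pV2 ?posrE //= divr_gt0.
have step k : (k <= N.+1)%N -> exists s, [/\ path (close d) (g 0) s,
    last (g 0) s = g (k%:R / N.+1%:R) & {in g 0 :: s, forall z, (g @` `[0, 1]) z}].
  elim: k => [_|k IH kN].
    exists [::]; split => //=; first by rewrite mul0r.
    by move=> z; rewrite inE => /eqP->; exists 0 => //=; rewrite in_itv /= lexx ler01.
  have I01 m : (m <= N.+1)%N ->
      0 <= (m%:R / N.+1%:R : R) <= 1.
    by move=> mN; rewrite divr_ge0 //= ler_pdivrMr // mul1r ler_nat.
  have [s [ps ls ins]] := IH (ltnW kN).
  exists (rcons s (g (k.+1%:R / N.+1%:R))); split.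
  - rewrite rcons_path ps ls; apply: h; rewrite ?I01 //; first exact: ltnW.
    by rewrite distrC -mulrBl -natrB // subSnn mul1r gtr0_norm ?invr_gt0.
  - by rewrite last_rcons.
  - move=> z; rewrite -rcons_cons mem_rcons inE => /orP[/eqP->|/ins //].
    by exists (k.+1%:R / N.+1%:R) => //=; rewrite in_itv /= I01.
have [s [ps ls ins]] := step _ (leqnn _).
by exists s; split => //; rewrite ls divff // gt_eqF.
Qed.

Lemma arc_chained p q K : is_arc p q K -> chained K p q.
Proof. by case=> g [cg _ <- <- ->]; exact: path_chained. Qed.

End Chains.

(** * Weakly planar relations *)

Definition independent (V : eqType) (u v a b : V) : bool :=
  [&& a != u, a != v, b != u & b != v].

(** Edges with a common endpoint may meet or even overlap, and [pt] may fail to be injective. The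
    sets [K u v] and [K v u] may differ, since the two ordered pairs are never independent. *)
Definition weakly_planar (R : realType) (V : finType) (E : rel V) : Prop :=
  exists (pt : V -> R * R) (K : V -> V -> set (R * R)),
    (forall u v, E u v -> compact (K u v) /\ chained (K u v) (pt u) (pt v)) /\
    (forall u v a b, E u v -> E a b -> independent u v a b ->
       K u v `&` K a b = set0).

(** * Replacing drawings by polygonal paths in general position *)

Section Polygons.
Variable R : realType.

Definition shear (e : R) (p : R * R) : R * R := (p.1 + e * p.2, p.2).

Lemma shear_disjoint e p q a b : segments_disjoint p q a b ->
  segments_disjoint (shear e p) (shear e q) (shear e a) (shear e b).
Proof.
move=> h x y hx hy /= e1 e2; apply: (h x y hx hy) => //.
suff : p.1 + x * (q.1 - p.1) + e * (p.2 + x * (q.2 - p.2)) =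
       a.1 + y * (b.1 - a.1) + e * (a.2 + y * (b.2 - a.2)) by rewrite e2 => /addIr.
by move: e1 => /eqP; rewrite -subr_eq0 => /eqP e1; apply/eqP; rewrite -subr_eq0;
  apply/eqP; rewrite -[RHS]e1; ring.
Qed.

Lemma generic_shear (s : seq (R * R)) : exists e : R,
  {in s &, forall p q, p != q -> (shear e p).1 != (shear e q).1}.
Proof.
(* [bad] is the shear at which two points of different heights get the same abscissa. The parameter
   chosen below exceeds all absolute values of [bad]. *)
pose bad (pq : (R * R) * (R * R)) := (pq.2.1 - pq.1.1) / (pq.1.2 - pq.2.2).
pose B := [seq `|bad pq| | pq <- [seq (p, q) | p <- s, q <- s]].
exists (1 + \sum_(x <- B) x) => p q ps qs pq; apply/negP => /eqP /= h.
set e := 1 + _ in h.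
have le : `|bad (p, q)| < e.
  rewrite /e; have h0 : 0 < 1 :> R := ltr01.
  have : bad (p, q) \in [seq bad x | x <- [seq (p, q) | p <- s, q <- s]].
    by apply: map_f; exact: allpairs_f.
  have -> : B = [seq `|x| | x <- [seq bad x | x <- [seq (p, q) | p <- s, q <- s]]].
    by rewrite -map_comp.
  move: (bad (p, q)) [seq bad x | x <- _] => x l xl.
  elim: l xl => // y l IH; rewrite inE big_cons => /orP[/eqP<-|/IH].
    have : 0 <= \sum_(j <- [seq `|x| | x <- l]) j.
      by rewrite big_map sumr_ge0.
    by move: h0; lra.
  by have := normr_ge0 y; move: h0; lra.
have e0 : 0 < e by exact: le_lt_trans le.
have [e2|ne2] := eqVneq p.2 q.2.
  case/negP: pq; rewrite [p]surjective_pairing [q]surjective_pairing e2.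
  by move: h; rewrite e2 => /addIr ->.
have := le; rewrite /bad /=.
have -> : q.1 - p.1 = e * (p.2 - q.2) by move: h; lra.
by rewrite mulfK ?subr_eq0 // gtr0_norm // ltxx.
Qed.

(** Each coordinate varies by less than [d / 2] along either segment, so a common point would make
    [p] and [a] close. *)
Lemma close_segments_disjoint (d : R) p q a b : close (d / 2) p q -> close (d / 2) a b ->
  ~~ close d p a -> segments_disjoint p q a b.
Proof.
case/andP=> h1 h2 /andP[h3 h4] /negP pa x y /andP[x0 x1] /andP[y0 y1] e1 e2; apply: pa.
have small (x' u v : R) : 0 <= x' -> x' <= 1 -> `|u - v| < d / 2 -> `|x' * (v - u)| < d / 2.
  move=> x'0 x'1 uv; rewrite normrM (ger0_norm x'0) distrC.
  by apply: le_lt_trans uv; rewrite ler_piMl.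
apply/andP; split.
  have -> : p.1 - a.1 = y * (b.1 - a.1) - x * (q.1 - p.1) by lra.
  apply: (le_lt_trans (ler_normB _ _)).
  by have := small x _ _ x0 x1 h1; have := small y _ _ y0 y1 h3; lra.
have -> : p.2 - a.2 = y * (b.2 - a.2) - x * (q.2 - p.2) by lra.
apply: (le_lt_trans (ler_normB _ _)).
by have := small x _ _ x0 x1 h2; have := small y _ _ y0 y1 h4; lra.
Qed.

Lemma close_paths_disjoint (d e : R) p s a t :
  path (close (d / 2)) p s -> path (close (d / 2)) a t ->
  {in p :: s & a :: t, forall z w, ~~ close d z w /\ (shear e z).1 != (shear e w).1} ->
  paths_disjoint (shear e p) (map (shear e) s) (shear e a) (map (shear e) t).
Proof.
move=> ps pt; elim: s p ps => [//|q s IH] p /= /andP[pq qs] h; split; last first.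
  by apply: IH => // z w zs wt; apply: h => //; rewrite inE zs orbT.
have {}h : {in [:: p; q] & a :: t, forall z w, ~~ close d z w /\ (shear e z).1 != (shear e w).1}.
  move=> z w; rewrite !inE => zs wt; apply: h => //.
  by case/orP: zs => /eqP->; rewrite !inE eqxx ?orbT.
elim: t a pt h {IH qs s} => [//|b t IH] a /= /andP[ab bt] h; split.
- by rewrite /distinct_abscissae; apply/and4P; split; apply: (h _ _ _ _).2;
    rewrite !inE eqxx ?orbT.
- apply/shear_disjoint/(close_segments_disjoint pq ab); apply: (h _ _ _ _).1.
    by rewrite !inE eqxx.
  by rewrite !inE eqxx.
- by apply: IH => // z w zs wt; apply: h => //; rewrite inE wt orbT.
Qed.

Lemma common_radius (I : finType) (P : I -> R -> Prop) :
  (forall i d d', P i d -> d' <= d -> P i d') ->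
  (forall i, exists2 d, 0 < d & P i d) -> exists2 d, 0 < d & forall i, P i d.
Proof.
move=> mono ex.
have /choice [f fP] : forall i, exists d, 0 < d /\ P i d.
  by move=> i; have [d] := ex i; exists d.
exists (\big[Num.min/1]_i f i).
  apply: (big_ind (fun x => 0 < x)) => // [x y hx hy|i _]; first by rewrite lt_min hx.
  by case: (fP i).
move=> i; apply: mono (fP i).2 _.
by rewrite (bigD1 i) //= ge_min lexx.
Qed.

Lemma weakly_planar_polygons (V : finType) (E : rel V) : weakly_planar R E ->
  exists (pt : V -> R * R) (S : V -> V -> seq (R * R)),
    (forall u v, E u v -> last (pt u) (S u v) = pt v) /\
    (forall u v a b, E u v -> E a b -> independent u v a b ->
       paths_disjoint (pt u) (S u v) (pt a) (S a b) /\
       distinct_abscissae (pt u) (pt v) (pt a) (pt b)).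
Proof.
move=> [pt [K [KP Kdis]]].
(* One radius separates all pairs of independent edges at once; chains with half this step then give
   disjoint polygons. *)
have [d d0 dP] : exists2 d : R, 0 < d & forall i : (V * V) * (V * V),
    E i.1.1 i.1.2 -> E i.2.1 i.2.2 -> independent i.1.1 i.1.2 i.2.1 i.2.2 ->
    forall x y, K i.1.1 i.1.2 x -> K i.2.1 i.2.2 y -> ~~ close d x y.
  apply: common_radius => [i d d' h dd h1 h2 h3 x y Kx Ky|[[u v] [a b]] /=].
    apply: contra (h h1 h2 h3 x y Kx Ky) => /andP[l1 l2].
    by apply/andP; split; [apply: lt_le_trans l1 dd|apply: lt_le_trans l2 dd].
  have [Euv|nE] := boolP (E u v); last by exists 1.
  have [Eab|nE] := boolP (E a b); last by exists 1.
  have [ind|nE] := boolP (independent u v a b); last by exists 1.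
  have [d d0 h] := compact_separated (KP _ _ Euv).1 (KP _ _ Eab).1 (Kdis _ _ _ _ Euv Eab ind).
  by exists d.
have d2 : 0 < d / 2 by lra.
have /choice [S SP] : forall uv : V * V, exists s : seq (R * R), E uv.1 uv.2 ->
    [/\ path (close (d / 2)) (pt uv.1) s, last (pt uv.1) s = pt uv.2 &
        {in pt uv.1 :: s, forall z, K uv.1 uv.2 z}].
  move=> [u v] /=; have [Euv|nE] := boolP (E u v); last by exists [::].
  by have [_ /(_ _ d2) [s ?]] := KP _ _ Euv; exists s.
pose all_points := flatten [seq pt uv.1 :: S uv | uv <- enum {: V * V}].
have [e eP] := generic_shear all_points.
have allP u v z : z \in pt u :: S (u, v) -> z \in all_points.
  move=> zs; apply/flattenP; exists (pt u :: S (u, v)) => //.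
  by apply/mapP; exists (u, v); rewrite ?mem_enum.
exists (fun u => shear e (pt u)), (fun u v => map (shear e) (S (u, v))); split.
  by move=> u v Euv; have [_ h _] := SP (u, v) Euv; rewrite last_map h.
move=> u v a b Euv Eab ind.
have [h1 h2 h3] := SP (u, v) Euv; have [k1 k2 k3] := SP (a, b) Eab.
have sep : {in pt u :: S (u, v) & pt a :: S (a, b),
    forall z w, ~~ close d z w /\ (shear e z).1 != (shear e w).1}.
  move=> z w zs ws.
  have nc := dP ((u, v), (a, b)) Euv Eab ind z w (h3 _ zs) (k3 _ ws).
  split=> //; apply: eP; [exact: allP zs|exact: allP ws|].
  by apply: contra nc => /eqP->; rewrite /close !subrr normr0 d0.
split; first exact: close_paths_disjoint h1 k1 sep.
have pu := mem_head (pt u) (S (u, v)); have pa := mem_head (pt a) (S (a, b)).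
have := mem_last (pt u) (S (u, v)); rewrite h2 => pv.
have := mem_last (pt a) (S (a, b)); rewrite k2 => pb.
by apply/and4P; split; apply: (sep _ _ _ _).2.
Qed.

(** * Exclusion of K5 and K33 *)

Section Kuratowski.
Variables (V : finType) (E : rel V).
Hypothesis wE : weakly_planar R E.

(** The geometry is reduced to two Boolean functions: [c] compares the abscissae of vertices, and
    [B u v a] is the parity with which the edge [u v] passes above [a]. What remains is linear
    algebra over the field with two elements. *)
Lemma crossing_equations : exists (c : V -> V -> bool) (B : V -> V -> V -> bool),
  forall u v a b, E u v -> E a b -> independent u v a b ->
   [/\ c u a = ~~ c a u, c u b = ~~ c b u, c v a = ~~ c a v, c v b = ~~ c b v &
   B u v a (+) B u v b (+) (B a b u (+) B a b v) (+)
    (c a u (+) c b u (+) (c a v (+) c b v)) = false].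
Proof.
have [pt [S [lastS dis]]] := weakly_planar_polygons wE.
exists (fun u v => (pt u).1 < (pt v).1), (fun u v w => path_below (pt w) (pt u) (S u v)).
move=> u v a b Euv Eab ind; have [disj ne] := dis _ _ _ _ Euv Eab ind.
case/and4P: ne => n1 n2 n3 n4; split.
- by case: ltgtP n1.
- by case: ltgtP n2.
- by case: ltgtP n3.
- by case: ltgtP n4.
by have := paths_parity disj; rewrite !lastS.
Qed.

(** Add the equations of all fifteen pairs of independent edges. Every value of [B] occurs twice,
    since a vertex outside an edge lies on exactly two edges independent of it. The order terms
    leave 1: any four of the vertices have exactly one interleaving pairing, which makes five in
    all. *)
Lemma no_K5 (v : nat -> V) : {in gtn 5 &, injective v} ->
  (forall i j, (i < 5)%N -> (j < 5)%N -> i != j -> E (v i) (v j)) -> False.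
Proof.
have [c [B cB]] := crossing_equations => inj EP.
pose par i j k l := B (v i) (v j) (v k) (+) B (v i) (v j) (v l) (+)
  (B (v k) (v l) (v i) (+) B (v k) (v l) (v j)) (+)
  (c (v k) (v i) (+) c (v l) (v i) (+) (c (v k) (v j) (+) c (v l) (v j))).
have ne i j : (i < 5)%N -> (j < 5)%N -> i != j -> v i != v j.
  by move=> i5 j5; apply: contra => /eqP /inj->.
have key i j k l : [&& i < 5, j < 5, k < 5 & l < 5]%N -> uniq [:: i; j; k; l] ->
    [/\ c (v i) (v k) = ~~ c (v k) (v i), c (v i) (v l) = ~~ c (v l) (v i),
        c (v j) (v k) = ~~ c (v k) (v j), c (v j) (v l) = ~~ c (v l) (v j) &
        par i j k l = false].
  case/and4P=> i5 j5 k5 l5; rewrite /= !inE !negb_or -!andbA.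
  case/and5P=> ij ik il jk /and3P[jl kl _].
  by apply: cB; rewrite ?EP //; apply/and4P; split; apply: ne; rewrite // eq_sym.
have neg i k : (i < 5)%N -> (k < 5)%N -> i != k -> c (v i) (v k) = ~~ c (v k) (v i).
  (* Antisymmetry is known only for ends of independent edges, so [i] and [k] are completed by two
     further indices. *)
  move=> i5 k5 ik; have [j [l h]] : exists j l, [&& (j < 5)%N, (l < 5)%N & uniq [:: i; j; k; l]].
    by case: i i5 ik => [|[|[|[|[|]]]]] //; case: k k5 => [|[|[|[|[|]]]]] //;
      (do ?[by exists 0%N, 1%N|by exists 0%N, 2%N|by exists 0%N, 3%N
           |by exists 1%N, 2%N|by exists 1%N, 3%N|by exists 2%N, 3%N|by exists 3%N, 4%N
           |by exists 2%N, 4%N|by exists 1%N, 4%N|by exists 0%N, 4%N]).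
  case/and3P: h => j5 l5 u; by have [] := key i j k l; rewrite ?i5 ?j5 ?k5 ?l5.
have keyP i j k l h u := let: And5 _ _ _ _ p := key i j k l h u in p.
pose total := (
  par 0 1 2 3 (+) par 0 1 2 4 (+) par 0 1 3 4 (+) par 0 2 1 3 (+)
  par 0 2 1 4 (+) par 0 2 3 4 (+) par 0 3 1 2 (+) par 0 3 1 4 (+)
  par 0 3 2 4 (+) par 0 4 1 2 (+) par 0 4 1 3 (+) par 0 4 2 3 (+)
  par 1 2 3 4 (+) par 1 3 2 4 (+) par 1 4 2 3)%N.
have tF : total = false by rewrite /total !keyP.
have : total = true.
  rewrite /total /par.
  rewrite (neg 1 2)%N // (neg 1 3)%N // (neg 1 4)%N // (neg 2 3)%N // (neg 2 4)%N // (neg 3 4)%N //.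
  by rewrite !addb_xorb; btauto.
by rewrite tF.
Qed.

(** As for K5, now with eighteen pairs of independent edges: again a vertex outside an edge lies on
    exactly two edges independent of it. *)
Lemma no_K33 (v : nat -> V) : {in gtn 6 &, injective v} ->
  (forall i j, (i < 3)%N -> (3 <= j < 6)%N -> E (v i) (v j)) -> False.
Proof.
have [c [B cB]] := crossing_equations => inj EP.
pose par i j k l := B (v i) (v j) (v k) (+) B (v i) (v j) (v l) (+)
  (B (v k) (v l) (v i) (+) B (v k) (v l) (v j)) (+)
  (c (v k) (v i) (+) c (v l) (v i) (+) (c (v k) (v j) (+) c (v l) (v j))).
have ne i j : (i < 6)%N -> (j < 6)%N -> i != j -> v i != v j.
  by move=> i6 j6; apply: contra => /eqP /inj->.
have key i j k l : [&& i < 3, k < 3, 3 <= j < 6 & 3 <= l < 6]%N -> uniq [:: i; j; k; l] ->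
    [/\ c (v i) (v k) = ~~ c (v k) (v i), c (v i) (v l) = ~~ c (v l) (v i),
        c (v j) (v k) = ~~ c (v k) (v j), c (v j) (v l) = ~~ c (v l) (v j) &
        par i j k l = false].
  case/and4P=> i3 k3 j6 l6; rewrite /= !inE !negb_or -!andbA.
  case/and5P=> ij ik il jk /and3P[jl kl _].
  by apply: cB; rewrite ?EP //; apply/and4P; split; apply: ne; rewrite 1?eq_sym //; lia.
have keyP i j k l h u := let: And5 _ _ _ _ p := key i j k l h u in p.
have negB j l : (3 <= j < 6)%N -> (3 <= l < 6)%N -> j != l -> c (v j) (v l) = ~~ c (v l) (v j).
  move=> j6 l6 jl; have [||//] := key 0%N j 1%N l; first by rewrite j6 l6.
  by rewrite /= !inE !negb_or jl; do !(apply/andP; split) => //; lia.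
pose total := (
  par 0 3 1 4 (+) par 0 3 1 5 (+) par 0 3 2 4 (+) par 0 3 2 5 (+)
  par 0 4 1 3 (+) par 0 4 1 5 (+) par 0 4 2 3 (+) par 0 4 2 5 (+)
  par 0 5 1 3 (+) par 0 5 1 4 (+) par 0 5 2 3 (+) par 0 5 2 4 (+)
  par 1 3 2 4 (+) par 1 3 2 5 (+) par 1 4 2 3 (+) par 1 4 2 5 (+)
  par 1 5 2 3 (+) par 1 5 2 4)%N.
have tF : total = false by rewrite /total !keyP.
have : total = true.
  rewrite /total /par (negB 3 4)%N // (negB 3 5)%N // (negB 4 5)%N //.
  by rewrite !addb_xorb; btauto.
by rewrite tF.
Qed.
End Kuratowski.
End Polygons.

(** * Vertex deletion, edge deletion and contraction *)

Section Counting.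
Variable V : finType.
Implicit Types (E : rel V) (A : {set V}).
Local Open Scope nat_scope.

Definition deg E x := #|[set y | E x y]%SET|.

(** Every edge of a symmetric relation is counted twice; in this form relations are compared
    termwise in double sums. *)
Definition arcs E := \sum_x deg E x.

Lemma degE E x : deg E x = \sum_y E x y.
Proof. by rewrite /deg cardsE -sum1_card big_mkcond. Qed.

Lemma arcsE E : arcs E = \sum_x \sum_y E x y.
Proof. by apply: eq_bigr => x _; rewrite degE. Qed.

Lemma sum_pred1 (a : V) (F : V -> nat) : \sum_x (x == a) * F x = F a.
Proof. by rewrite (bigD1 a) //= eqxx mul1n big1 ?addn0 // => x /negbTE->. Qed.

Definition del_vertex v E : rel V := fun x y => [&& x != v, y != v & E x y].

Lemma arcs_del_vertex v E : symmetric E -> irreflexive E ->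
  arcs E = arcs (del_vertex v E) + 2 * deg E v.
Proof.
move=> sE iE; rewrite !arcsE degE.
transitivity (\sum_x \sum_y (del_vertex v E x y + (x == v) * E v y + (y == v) * E v x)).
  apply: eq_bigr => x _; apply: eq_bigr => y _; rewrite /del_vertex.
  case: eqVneq => [->|xv]; case: eqVneq => [->|yv] //=; rewrite ?iE ?mul0n ?mul1n ?addn0 //.
  by rewrite sE.
under eq_bigr do rewrite !big_split /= -big_distrr /=.
rewrite !big_split /= mul2n -addnn addnA; congr (_ + _ + _).
  exact: (sum_pred1 v (fun=> \sum_y E v y)).
by apply: eq_bigr => x _; rewrite (sum_pred1 v (fun=> E v x : nat)).
Qed.

Lemma arcs_le E E' : (forall x y, E x y -> E' x y) -> arcs E <= arcs E'.
Proof.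
move=> h; rewrite !arcsE; apply: leq_sum => x _; apply: leq_sum => y _.
by move: (h x y); case: (E x y); case: (E' x y) => // /(_ isT).
Qed.

Definition del_edge u v E : rel V :=
  fun x y => E x y && ~~ ((x == u) && (y == v) || (x == v) && (y == u)).

Lemma arcs_del_edge u v E : symmetric E -> irreflexive E -> E u v ->
  arcs E = arcs (del_edge u v E) + 2.
Proof.
move=> sE iE Euv; rewrite !arcsE.
have uv : u != v by apply: contraTneq Euv => ->; rewrite iE.
transitivity (\sum_x \sum_y (del_edge u v E x y + (x == u) * (y == v) + (x == v) * (y == u))).
  apply: eq_bigr => x _; apply: eq_bigr => y _; rewrite /del_edge.
  have h1 : x == u -> y == v -> E x y by move=> /eqP-> /eqP->.
  have h2 : x == v -> y == u -> E x y by move=> /eqP-> /eqP->; rewrite sE.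
  have h3 : x == u -> x == v -> false by move=> /eqP->; rewrite (negbTE uv).
  move: h1 h2 h3; move: (x == u) (x == v) (y == u) (y == v) (E x y).
  move=> [] [] [] [] [] h1 h2 h3 //=;
    first [by move: (h1 isT isT)|by move: (h2 isT isT)|by move: (h3 isT isT)].
under eq_bigr do rewrite !big_split /= -!big_distrr /=.
rewrite !big_split /= -addnA; congr (_ + _).
rewrite (sum_pred1 u (fun=> \sum_i (i == v))) (sum_pred1 v (fun=> \sum_i (i == u))).
have one (a : V) : \sum_i (i == a) = 1.
  by rewrite -[RHS](sum_pred1 a (fun=> 1)); apply: eq_bigr => i _; rewrite muln1.
by rewrite !one.
Qed.

(** The vertex [v] is merged into [u] and stays in the type as an isolated vertex; [supported] will
    record which vertices count. *)
Definition contract u v E : rel V := fun x y =>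
  [&& x != v, y != v, x != y &
      [|| E x y, (x == u) && E v y | (y == u) && E x v]].

Lemma contract_sym u v E : symmetric E -> symmetric (contract u v E).
Proof.
move=> sE x y; rewrite /contract [E y x]sE [E v x]sE [E y v]sE [y == x]eq_sym andbCA.
by congr [&& _, _, _ & _]; congr (_ || _); rewrite orbC.
Qed.

Lemma contract_irr u v E : irreflexive (contract u v E).
Proof. by move=> x; rewrite /contract eqxx /= !andbF. Qed.

(** Apart from the edge [u v] itself, only the double edges to common neighbours are lost; [Q] marks
    the neighbours that [u] gains from [v]. *)
Lemma arcs_contract u v E : symmetric E -> irreflexive E -> E u v ->
  arcs E <= arcs (contract u v E) + 2 + 2 * #|[set z | E u z && E v z]%SET|.
Proof.
move=> sE iE Euv; rewrite (arcs_del_vertex v sE iE).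
pose Q y := [&& y != u, E v y & ~~ E u y].
have uv : u != v by apply: contraTneq Euv => ->; rewrite iE.
have Qv y : Q y -> y != v by rewrite /Q; apply: contraTneq => ->; rewrite iE andbF.
have dv : deg E v <= 1 + #|[set z | E u z && E v z]%SET| + \sum_y Q y.
  have -> : 1 = \sum_y (y == u).
    by rewrite -(sum_pred1 u (fun=> 1)); apply: eq_bigr => i _; rewrite muln1.
  rewrite degE cardsE -sum1_card [X in _ + X + _]big_mkcond -!big_split /=.
  apply: leq_sum => y _; rewrite /Q unfold_in /=; case: (eqVneq y u) => [->|_] /=.
    by case: (E v u).
  by case: (E v y); case: (E u y).
have : arcs (del_vertex v E) + 2 * \sum_y Q y <= arcs (contract u v E).
  rewrite !arcsE.
  have -> : 2 * \sum_y Q y =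
      \sum_x \sum_y (x == u) * Q y + \sum_x \sum_y (y == u) * Q x.
    rewrite mul2n -addnn; congr (_ + _).
      rewrite -[LHS](sum_pred1 u (fun=> \sum_y Q y)).
      by apply: eq_bigr => x _; rewrite big_distrr.
    by apply: eq_bigr => x _; rewrite (sum_pred1 u (fun=> Q x : nat)).
  rewrite addnA -!big_split /=; apply: leq_sum => x _.
  rewrite -!big_split /=; apply: leq_sum => y _.
  have Qu : Q u = false by rewrite /Q eqxx.
  have neE a b : E a b -> a != b by apply: contraTneq => ->; rewrite iE.
  have := Qv x; have := Qv y; have := neE x y; rewrite /del_vertex /contract.
  have [->|xu] := eqVneq x u.
    rewrite Qu muln0 addn0 mul1n uv /= /Q [y == u]eq_sym.
    by case: (u == y) (y == v) (E u y) (E v y) => [] [] [] [] //= a b c;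
      try first [by move: (a isT)|by move: (b isT)].
  have [->|yu] := eqVneq y u; rewrite /= ?mul0n ?addn0 ?mul1n.
    rewrite uv xu /= /Q xu [E x u]sE [E x v]sE.
    by case: (x == v) (E u x) (E v x) => [] [] [] //= a b c; try first [by move: (c isT)].
  by case: (x == y) (x == v) (y == v) (E x y) => [] [] [] [] //= a; try first [by move: (a isT)].
move=> h.
have : 2 * deg E v <= 2 * (1 + #|[set z | E u z && E v z]%SET| + \sum_y Q y).
  by rewrite leq_mul2l dv orbT.
lia.
Qed.

End Counting.

(** * The edge bound *)

Section EdgeBound.
Variables (R : realType) (V : finType).
Implicit Types (E : rel V) (A : {set V}).

Lemma weakly_planar_sub E E' : (forall x y, E' x y -> E x y) ->
  weakly_planar R E -> weakly_planar R E'.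
Proof.
move=> sub [pt [K [KP Kd]]]; exists pt, K; split=> [u v /sub|u v a b /sub h1 /sub h2].
  exact: KP.
exact: Kd.
Qed.

Lemma weakly_planar_contract E u v : symmetric E -> E u v ->
  weakly_planar R E -> weakly_planar R (contract u v E).
Proof.
move=> sE Euv [pt [K [KP Kd]]].
have Evu : E v u by rewrite sE.
exists pt, (fun x y => if E x y then K x y else
  if (x == u) && E v y then K u v `|` K v y else K x v `|` K v u).
have join a b c : E a b -> E b c ->
    compact (K a b `|` K b c) /\ chained (K a b `|` K b c) (pt a) (pt c).
  move=> Eab Ebc; have [c1 h1] := KP _ _ Eab; have [c2 h2] := KP _ _ Ebc.
  split; first exact: compactU.
  apply: (chained_trans (q := pt b)).
    by apply: (chained_sub _ h1) => z; left.
  by apply: (chained_sub _ h2) => z; right.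
(* A new edge consists of old edges whose ends are its own ends and possibly [v], and [v] occurs
   only if [u] is an end. Of two independent new edges at most one has the end [u], so all their
   pieces are independent. *)
have pieces x y : contract u v E x y ->
  exists p q r s, [/\ E p q, E r s,
    (if E x y then K x y else
     if (x == u) && E v y then K u v `|` K v y else K x v `|` K v u) `<=` K p q `|` K r s &
    forall w, w \in [:: p; q; r; s] -> [|| w == x, w == y | (w == v) && ((u == x) || (u == y))]].
  rewrite /contract => /and4P[xv yv xy]; case: ifPn => [Exy _|nE /=].
    exists x, y, x, y; split=> // w.
    by rewrite !inE => /or4P[] /eqP->; rewrite eqxx ?orbT.
  case: ifPn => [/andP[/eqP-> Evy] _|_ /= /andP[/eqP-> Exv]].
    exists u, v, v, y; split=> // w.
    by rewrite !inE => /or4P[] /eqP->; rewrite !eqxx ?orbT.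
  exists x, v, v, u; split=> // w.
  by rewrite !inE => /or4P[] /eqP->; rewrite !eqxx ?orbT.
split.
  move=> x y; rewrite /contract => /and4P[xv yv xy]; case: ifPn => [Exy _|nE /=]; first exact: KP.
  case: ifPn => [/andP[/eqP-> Evy] _|_ /= /andP[/eqP-> Exv]]; first exact: join.
  by apply: join; rewrite // sE.
move=> x y a b Cxy Cab /and4P[ax ay bx b_y].
have nv c d : contract u v E c d -> (c != v) && (d != v) by case/and4P=> -> ->.
have /andP[xv yv] := nv _ _ Cxy; have /andP[av bv] := nv _ _ Cab.
have [p [q [r [s [Epq Ers sub1 in1]]]]] := pieces _ _ Cxy.
have [p' [q' [r' [s' [Epq' Ers' sub2 in2]]]]] := pieces _ _ Cab.
have disj w w' : w \in [:: p; q; r; s] -> w' \in [:: p'; q'; r'; s'] -> w' != w.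
  move=> /in1 h1 /in2 h2; apply/eqP => ww; move: h2; rewrite ww.
  case/or3P: h1 => [/eqP->|/eqP->|/andP[/eqP-> h1]].
  - by rewrite [x == a]eq_sym [x == b]eq_sym (negbTE ax) (negbTE bx) (negbTE xv).
  - by rewrite [y == a]eq_sym [y == b]eq_sym (negbTE ay) (negbTE b_y) (negbTE yv).
  - rewrite eqxx [v == a]eq_sym [v == b]eq_sym (negbTE av) (negbTE bv) /=.
    move: ax ay bx b_y; case/orP: h1 => /eqP <- h1 h2 h3 h4;
      by rewrite [u == a]eq_sym [u == b]eq_sym ?(negbTE h1) ?(negbTE h2) ?(negbTE h3) ?(negbTE h4).
rewrite -subset0 => z [/sub1 h1 /sub2 h2].
have mem4 (T : eqType) (c d e f : T) : [/\ c \in [:: c; d; e; f], d \in [:: c; d; e; f],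
    e \in [:: c; d; e; f] & f \in [:: c; d; e; f]] by split; rewrite !inE eqxx ?orbT.
have [m1 m2 m3 m4] := mem4 _ p q r s; have [n1 n2 n3 n4] := mem4 _ p' q' r' s'.
case: h1 => h1; case: h2 => h2.
- by rewrite -(Kd _ _ _ _ Epq Epq') //; apply/and4P; split; apply: disj.
- by rewrite -(Kd _ _ _ _ Epq Ers') //; apply/and4P; split; apply: disj.
- by rewrite -(Kd _ _ _ _ Ers Epq') //; apply/and4P; split; apply: disj.
- by rewrite -(Kd _ _ _ _ Ers Ers') //; apply/and4P; split; apply: disj.
Qed.

Local Open Scope nat_scope.

Lemma no_clique5 E (s : seq V) : weakly_planar R E -> size s = 5 -> uniq s ->
  {in s &, forall x y, x != y -> E x y} -> False.
Proof.
move=> wE s5 us cl.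
have [x0 _] : exists x0, x0 \in s by case: s s5 {us cl} => // a s _; exists a; rewrite mem_head.
apply: (no_K5 wE (v := nth x0 s)).
  move=> i j i5 j5 /eqP; rewrite (nth_uniq _ _ _ us) ?s5; [by move/eqP|exact: i5|exact: j5].
move=> i j i5 j5 ij; rewrite -s5 in i5 j5.
by apply: cl; rewrite ?mem_nth // nth_uniq.
Qed.

Lemma no_biclique3 E (s t : seq V) : weakly_planar R E -> size s = 3 -> size t = 3 ->
  uniq (s ++ t) -> {in s & t, forall x y, E x y} -> False.
Proof.
move=> wE s3 t3 us cl.
have [x0 _] : exists x0, x0 \in s by case: s s3 {us cl} => // a s _; exists a; rewrite mem_head.
have st6 : size (s ++ t) = 6 by rewrite size_cat s3 t3.
apply: (no_K33 wE (v := nth x0 (s ++ t))).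
  move=> i j i6 j6 /eqP; rewrite (nth_uniq _ _ _ us) ?st6; [by move/eqP|exact: i6|exact: j6].
move=> i j i3 j6; rewrite !nth_cat s3 i3 ltnNge (andP j6).1 /=.
by apply: cl; rewrite mem_nth ?s3 ?t3 //; lia.
Qed.

Lemma common_nbr_subset E v z : symmetric E -> irreflexive E -> E v z ->
  [set y | E v y && E z y]%SET \subset [set y | E v y]%SET :\ z.
Proof.
move=> sE iE Evz; apply/fintype.subsetP => y; rewrite !inE => /andP[-> Ezy].
by rewrite andbT; apply: contraTneq Ezy => ->; rewrite iE.
Qed.

(** Each vertex of the neighbourhood [N] has at least three neighbours in [N]. With four vertices,
    [N] is complete and [v] extends it to K5. With five, [N] is a K5 or has non-adjacent vertices
    [a] and [b], both joined to the other three, and [v] completes a K33. *)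
Lemma low_degree_obstruction E v : symmetric E -> irreflexive E -> weakly_planar R E ->
  3 < deg E v <= 5 -> (forall z, E v z -> 2 < #|[set y | E v y && E z y]%SET|) -> False.
Proof.
move=> sE iE wE dv com; pose N := [set y | E v y]%SET.
have inN y : (y \in N) = E v y by rewrite inE.
have vN : v \notin N by rewrite inN iE.
have cN : #|N| = deg E v by [].
have sizeN (S : {set V}) : size (enum S) = #|S| by rewrite cardE.
have [d4|d5] : deg E v = 4 \/ deg E v = 5 by lia.
  apply: (@no_clique5 E (v :: enum N) wE); first by rewrite /= sizeN cN d4.
    by rewrite /= mem_enum vN enum_uniq.
  move=> x y; rewrite !inE !mem_enum !inN => /orP[/eqP->|Evx] /orP[/eqP->|Evy] //.
  - by rewrite eqxx.
  - by rewrite sE.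
  move=> xy; have := common_nbr_subset sE iE Evx => sub.
  have /eqP eN : [set y | E v y && E x y]%SET == N :\ x.
    rewrite eqEcard sub /=; have := com _ Evx; have := cardsD1 x N.
    by rewrite inN Evx cN d4; lia.
  have : y \in N :\ x by rewrite !inE eq_sym xy.
  by rewrite -eN inE => /andP[].
have [|noncl] := boolP [forall x in N, forall y in N, (x != y) ==> E x y].
  move=> cl; apply: (@no_clique5 E (enum N) wE); rewrite ?sizeN ?cN ?enum_uniq //.
  move=> x y; rewrite !mem_enum => xN yN xy.
  by move/forall_inP: cl => /(_ x xN)/forall_inP/(_ y yN)/implyP; apply.
have [a [b [Na Nb ab nE]]] : exists a b, [/\ a \in N, b \in N, a != b & ~~ E a b].
  move: noncl; rewrite negb_forall => /existsP[a]; rewrite negb_imply => /andP[Na].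
  rewrite negb_forall => /existsP[b]; rewrite !negb_imply => /and3P[Nb ab nE].
  by exists a, b.
pose M := N :\ a :\ b.
have cM : #|M| = 3.
  have := cardsD1 a N; have := cardsD1 b (N :\ a).
  by rewrite !inE -!inN Nb Na [b == a]eq_sym ab /= cN d5 /M; lia.
have full c d : c \in N -> M = N :\ c :\ d -> ~~ E c d -> {in M, forall y, E c y}.
  move=> cN' Mcd nEcd y yM; rewrite inN in cN'.
  have sub : [set y | E v y && E c y]%SET \subset M.
    rewrite Mcd; apply/fintype.subsetP => w wS; have := fintype.subsetP (common_nbr_subset sE iE cN') _ wS.
    rewrite !inE => /andP[-> ->]; rewrite !andbT; move: wS; rewrite inE => /andP[_].
    by apply: contraTneq => ->.
  have /eqP eM : [set y | E v y && E c y]%SET == M.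
    by rewrite eqEcard sub cM; apply: com.
  by move: yM; rewrite -eM inE => /andP[].
have fa := full a b Na erefl nE.
have fb : {in M, forall y, E b y}.
  apply: (full b a Nb) => //; last by rewrite sE.
  by apply/finset.setP => w; rewrite !inE andbCA.
apply: (@no_biclique3 E [:: v; a; b] (enum M) wE); rewrite ?sizeN //.
  rewrite /= !inE !mem_enum !inE !eqxx iE !negb_or ab enum_uniq /= !andbF !andbT.
  by apply/andP; split; [apply: contraNneq vN => ->|apply: contraNneq vN => ->].
move=> x y; rewrite !inE mem_enum => /or3P[] /eqP-> yM; [|exact: fa|exact: fb].
by move: yM; rewrite !inE => /and3P[].
Qed.

Lemma del_vertex_sym E v : symmetric E -> symmetric (del_vertex v E).
Proof. by move=> sE x y; rewrite /del_vertex sE andbCA. Qed.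

Lemma del_vertex_irr E v : irreflexive E -> irreflexive (del_vertex v E).
Proof. by move=> iE x; rewrite /del_vertex iE !andbF. Qed.

Lemma del_edge_sym E u v : symmetric E -> symmetric (del_edge u v E).
Proof.
move=> sE x y; rewrite /del_edge sE; congr (_ && ~~ _).
by rewrite orbC [(x == v) && _]andbC [(x == u) && _]andbC.
Qed.

Lemma del_edge_irr E u v : irreflexive E -> irreflexive (del_edge u v E).
Proof. by move=> iE x; rewrite /del_edge iE. Qed.

Definition supported E A := forall x y, E x y -> x \in A.

Lemma deg_out E A x : supported E A -> x \notin A -> deg E x = 0.
Proof.
move=> sup xA; apply/eqP; rewrite cards_eq0 -finset.subset0; apply/fintype.subsetP => y.
by rewrite inE => /sup; rewrite (negbTE xA).
Qed.

Lemma arcs_supported E A : supported E A -> arcs E = \sum_(x in A) deg E x.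
Proof.
move=> sup; rewrite /arcs (bigID (mem A)) /= [X in _ + X]big1 ?addn0 // => x.
exact: deg_out.
Qed.

Lemma deg_supported E A x : symmetric E -> irreflexive E -> supported E A ->
  x \in A -> deg E x <= #|A|.-1.
Proof.
move=> sE iE sup xA; rewrite [in leqRHS](cardsD1 x A) xA /=; apply: subset_leq_card.
apply/fintype.subsetP => y; rewrite !inE sE => Eyx; rewrite (sup _ _ Eyx) andbT.
by apply: contraTneq Eyx => ->; rewrite iE.
Qed.

Lemma low_degree_vertex E A k : supported E A -> arcs E < k.+1 * #|A| ->
  exists2 v, v \in A & deg E v <= k.
Proof.
move=> sup; rewrite (arcs_supported sup) => lt.
have [/exists_inP[v vA vk]|/exists_inPn h] := boolP [exists v in A, deg E v <= k].
  by exists v.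
move: lt; rewrite ltnNge mulnC -sum_nat_const => /negP[]; apply: leq_sum => x xA.
by rewrite ltnNge h.
Qed.

Lemma arcs_max E : arcs E <= #|V| * #|V|.
Proof.
rewrite -sum_nat_const; apply: leq_sum => x _; exact: max_card.
Qed.

(* Mader's argument: a minimal counterexample has exactly 3m-5 edges, so it has
   a vertex of degree at most 5, and contracting an edge at that vertex loses at
   least four edges; hence its neighbourhood has minimum degree 3. *)
Lemma arcs_bound E A : symmetric E -> irreflexive E -> supported E A ->
  weakly_planar R E -> 3 <= #|A| -> arcs E + 12 <= 6 * #|A|.
Proof.
(* This measure is lexicographic in [#|A|] and [arcs E], because the latter never exceeds
   [#|V| * #|V|]. *)
have [n] := ubnP (#|A| * (#|V| * #|V|).+1 + arcs E); elim: n => // n IH in E A *.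
move=> lt_n sE iE sup wE A3.
rewrite leqNgt; apply/negP => big.
have [much|few] := ltnP (6 * #|A|) (arcs E + 10).
  have [x [y Exy]] : exists x y, E x y.
    have [/existsP[x /existsP[y Exy]]|/existsPn h] := boolP [exists x, exists y, E x y].
      by exists x, y.
    have a0 : arcs E = 0.
      by rewrite arcsE big1 // => x _; rewrite big1 // => y _; have /existsPn/(_ y)/negbTE-> := h x.
    by lia.
  have aE := arcs_del_edge sE iE Exy.
  have sub a b : del_edge x y E a b -> E a b by case/andP.
  suff : arcs (del_edge x y E) + 12 <= 6 * #|A| by lia.
  apply: IH => //; [lia|exact: del_edge_sym|exact: del_edge_irr|by move=> a b /sub /sup|].
  exact: weakly_planar_sub wE.
have [A3'|A4] := leqP #|A| 3.
  have : arcs E <= \sum_(x in A) 2.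
    rewrite (arcs_supported sup); apply: leq_sum => x xA.
    by apply: (leq_trans (deg_supported sE iE sup xA)); lia.
  by rewrite sum_nat_const; lia.
have [v vA dv] : exists2 v, v \in A & deg E v <= 5 by apply: low_degree_vertex sup _; lia.
have cA := cardsD1 v A; rewrite vA in cA.
have [dv3|dv3] := leqP (deg E v) 3.
  suff : arcs (del_vertex v E) + 12 <= 6 * #|A :\ v| by have := arcs_del_vertex v sE iE; lia.
  have sub a b : del_vertex v E a b -> E a b by case/and3P.
  apply: IH => //.
  - by have := arcs_le sub; rewrite cA mulnDl mul1n in lt_n; lia.
  - exact: del_vertex_sym.
  - exact: del_vertex_irr.
  - by move=> a b /and3P[av _ /sup aA]; rewrite !inE av.
  - exact: weakly_planar_sub wE.
  - by lia.
apply: (low_degree_obstruction sE iE wE (v := v)); first by rewrite dv3 dv.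
move=> z Evz; rewrite ltnNge; apply/negP => com.
have Ezv : E z v by rewrite sE.
have arc := arcs_contract sE iE Ezv.
have {}com : #|[set w | E z w && E v w]%SET| <= 2.
  apply: leq_trans com; apply: subset_leq_card.
  by apply/fintype.subsetP => w; rewrite !inE andbC.
suff : arcs (contract z v E) + 12 <= 6 * #|A :\ v| by lia.
have cAv : #|A| * (#|V| * #|V|).+1 = (#|V| * #|V|).+1 + #|A :\ v| * (#|V| * #|V|).+1.
  by rewrite cA mulnDl mul1n.
apply: IH => //.
- by have := arcs_max (contract z v E); lia.
- exact: contract_sym.
- exact: contract_irr.
- move=> a b /and4P[av bv ab]; rewrite !inE av /= => /or3P[/sup //|/andP[/eqP-> _]|/andP[_ /sup //]].
  exact: sup Ezv.
- exact: weakly_planar_contract.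
- by lia.
Qed.
End EdgeBound.

(** * Plane graphs *)

Lemma edge_mem (V : finType) (G : sgraph V) u v : G u v -> [set u; v]%SET \in edges G.
Proof. by move=> Guv; apply/imsetP; exists (u, v); rewrite ?inE. Qed.

Lemma set2_inj (V : finType) (a b u v : V) : [set a; b]%SET = [set u; v]%SET ->
  (a = u /\ b = v) \/ (a = v /\ b = u).
Proof.
move=> e.
have : a \in [set u; v]%SET by rewrite -e !inE eqxx.
have : b \in [set u; v]%SET by rewrite -e !inE eqxx orbT.
have : u \in [set a; b]%SET by rewrite e !inE eqxx.
have : v \in [set a; b]%SET by rewrite e !inE eqxx orbT.
rewrite !inE => /orP[]/eqP h1 /orP[]/eqP h2 /orP[]/eqP h3 /orP[]/eqP h4;
  subst; by [left|right].
Qed.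

Lemma plane_weakly_planar (R : realType) (V : finType) (G : sgraph V) pt arc :
  @plane_drawing R V G pt arc -> weakly_planar R G.
Proof.
case=> ptI arcP _ cross; exists pt, (fun u v => arc [set u; v]%SET); split.
  by move=> u v /arcP h; split; [exact: arc_compact h|exact: arc_chained h].
move=> u v a b Guv Gab /and4P[au av bu bv]; rewrite -subset0 => z [z1 z2].
have [|w [+ + _]] := cross _ _ (edge_mem Guv) (edge_mem Gab) _ z z1 z2.
  apply/eqP => /set2_inj[[e _]|[_ e]]; first by rewrite e eqxx in au.
  by rewrite e eqxx in av.
rewrite !inE => /orP[]/eqP-> /orP[]/eqP e; move: au av bu bv; by rewrite e eqxx.
Qed.

Lemma arcs_card (V : finType) (E : rel V) : arcs E = #|[set p : V * V | E p.1 p.2]%SET|.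
Proof.
rewrite arcsE pair_bigA /= cardsE -sum1_card [RHS]big_mkcond /=.
by apply: eq_bigr => p _; rewrite unfold_in; case: (E _ _).
Qed.

Lemma double_num_edges (V : finType) (G : sgraph V) : (2 * num_edges G = arcs G)%N.
Proof.
rewrite arcs_card -sum1_card (partition_big_imset (fun p => [set p.1; p.2]%SET)) /=.
rewrite mulnC -sum_nat_const; apply: eq_big => // e /imsetP[[u v]]; rewrite inE /= => Guv ->.
have uv : u != v by apply: contraTneq Guv => ->; rewrite adj_irr.
transitivity #|[set (u, v); (v, u)]%SET|.
  by rewrite cards2 xpair_eqE (negbTE uv).
rewrite -sum1_card; apply: eq_bigl => -[a b]; rewrite !inE /= !xpair_eqE.
apply/idP/idP.
  by case/orP => /andP[/eqP-> /eqP->]; rewrite ?Guv ?eqxx //= adj_sym Guv finset.setUC eqxx.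
by case/andP=> _ /eqP/set2_inj[[-> ->]|[-> ->]]; rewrite !eqxx ?orbT.
Qed.

Lemma plane_edge_bound (R : realType) (V : finType) (G : sgraph V) :
  weakly_planar R G -> (3 <= #|V|)%N -> (num_edges G + 6 <= 3 * #|V|)%N.
Proof.
move=> wG V3.
have := @arcs_bound R V G [set: V]%SET (adj_sym G) (adj_irr G) _ wG.
rewrite cardsT -double_num_edges => /(_ _ V3) h; suff : (2 * num_edges G + 12 <= 6 * #|V|)%N by lia.
by apply: h => x y _; rewrite inE.
Qed.

Lemma subgraph_num_edges (W V : finType) (H : sgraph W) (G : sgraph V) :
  iso_to_subgraph H G -> (num_edges H <= num_edges G)%N.
Proof.
case=> f injf hf; rewrite /num_edges.
rewrite -(card_imset (mem (edges H)) (imset_inj injf)); apply: subset_leq_card.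
apply/fintype.subsetP => e0 /imsetP[e /imsetP[[u v]]]; rewrite inE /= => Huv -> ->.
by rewrite imsetU !imset_set1; apply/edge_mem/hf.
Qed.

(** * Saturation, and separation by closed curves *)

Section Saturation.
Variables (R : realType) (V : finType) (G : sgraph V).

Lemma add_edge_sub (H : sgraph V) u v x y : H x y -> add_edge H u v x y.
Proof. by move=> h; rewrite /= /add_edge_rel h. Qed.

(** The curves of [H0] are kept along with its edges, since the closed curves used for separation
    are composed of them. *)
Lemma saturation (H0 : plane_graph R V) : iso_to_subgraph H0 G ->
  exists H : plane_graph R V, [/\ plane_saturated_subgraph H G,
    forall u v, H0 u v -> H u v, pg_pt H = pg_pt H0 &
    forall u v, H0 u v -> pg_arc H [set u; v]%SET = pg_arc H0 [set u; v]%SET].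
Proof.
have [n] := ubnP (#|V| * #|V| - arcs H0)%N; elim: n => // n IH in H0 * => lt iso.
have [sat|] := pselect (plane_saturated_subgraph H0 G); first by exists H0; split.
move=> nsat; have [u [v [A [uv nH dr iso']]]] : exists u v A, [/\ u != v, ~~ H0 u v,
    plane_drawing (add_edge H0 u v) (pg_pt H0)
          (fun e => if e == [set u; v]%SET then A else pg_arc H0 e) &
    iso_to_subgraph (add_edge H0 u v) G].
  apply: contrapT => no; apply: nsat; split => // u v A uv nH dr iso'; apply: no.
  by exists u, v, A.
pose H1 := PlaneGraph dr.
have [||H [sat sub ept earc]] := IH H1.
- have : (arcs H0 < arcs (add_edge H0 u v))%N.
    have h : (arcs H0 <= arcs (del_edge u v (add_edge H0 u v)))%N.
      apply: arcs_le => x y Hxy; rewrite /del_edge add_edge_sub //=.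
      apply: contra nH => /orP[]/andP[/eqP e1 /eqP e2]; last by rewrite adj_sym -e1 -e2.
      by rewrite -e1 -e2.
    have Auv : add_edge H0 u v u v by rewrite /= /add_edge_rel uv eqxx orbT.
    have := arcs_del_edge (adj_sym (add_edge H0 u v)) (adj_irr (add_edge H0 u v)) Auv.
    by lia.
  have := arcs_max (add_edge H0 u v); rewrite /H1 /=.
  set a := arcs (add_edge_rel _ _ _); set N := (#|V| * #|V|)%N; move: lt; rewrite -/N; lia.
- exact: iso'.
exists H; split => //.
  by move=> x y Hxy; apply: sub; apply: add_edge_sub.
move=> x y Hxy; rewrite earc; last exact: add_edge_sub.
rewrite /= ifN //; apply: contra nH => /eqP/set2_inj[[<- <-]|[<- <-]] //.
by rewrite adj_sym.
Qed.

(* The zero set of [m] plays the role of a closed curve covered by the edges in [B]. *)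
Lemma separation (H : plane_graph R V) (m : R * R -> R) (B : {set {set V}}) a c :
  continuous m -> B \subset edges H ->
  (forall z, m z = 0 -> exists2 e, e \in B & pg_arc H e z) ->
  H a c -> 0 < m (pg_pt H a) -> m (pg_pt H c) <= 0 ->
  exists2 e, e \in B & (a \in e) || (c \in e).
Proof.
move=> cm subB cov Hac ma mc; have [ptI arcP _ cross] := pg_drawing H.
have [g [cg injg g0 g1 eA]] := arcP a c Hac.
have [||x x01 mx] := @IVT R (m \o g) 0 1 0 ler01.
- apply/subspace_continuousP => x x01; move/subspace_continuousP/(_ x x01): cg => cgx.
  by apply: (cvg_comp _ _ cgx); exact: cm.
- by rewrite /= g0 g1; rewrite minEle maxEle; case: ifP; lra.
have [e eB ez] := cov _ mx.
have gA : pg_arc H [set a; c]%SET (g x) by rewrite eA; exists x.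
exists e => //.
have [->|ne] := eqVneq e [set a; c]%SET; first by rewrite !inE eqxx.
have [w [w1 w2 _]] := cross _ _ (fintype.subsetP subB _ eB) (edge_mem Hac) ne _ ez gA.
by move: w2; rewrite !inE => /orP[]/eqP <-; rewrite w1 ?orbT.
Qed.
End Saturation.

(** * A straight-line drawing on sites *)

(** One catalogue of positions serves all constructions. [FarTop] and [FarAxis] lie to the left of
    the line through [Top] and [Bot], the axis to its right. [Wedge] places lie between consecutive
    segments issuing from [Top], and [Low] places lie under the axis. *)
Inductive site := Top | Bot | FarTop | Axis of nat | FarAxis of nat | Wedge of nat | Low of nat.

(** All these segments together are free of crossings, so every relation mapped into them is drawn
    in the plane. Each pair is listed in one direction only. *)
Definition site_edge (p q : site) : bool :=
  match p, q with
  | Top, Bot | Top, Axis _ | Bot, Axis _ | FarTop, FarAxis _ => true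
  | Axis i, Axis j => j == i.+1
  | _, _ => false
  end.

Section Sites.
Variable R : realType.
Implicit Types (p q r : site) (z : R * R).

(** At height 1/2 the segments from [Top] to [Bot] and to the axis have the abscissae [i / 2], and
    [Wedge i] is halfway between two of them. The [Low] abscissae stay between 1/2 and 3/4 for every
    index, hence between the first two segments from [Bot] to the axis. *)
Definition coord p : R * R :=
  match p with
  | Top => (0, 1)
  | Bot => (0, -1)
  | FarTop => (-1, 1)
  | Axis i => (i.+1%:R, 0)
  | FarAxis i => (- i.+2%:R, 0)
  | Wedge i => ((2 * i + 1)%:R / 4, 1 / 2)
  | Low i => (1 / 2 + (2 * i.+2%:R)^-1, - (1 / 2))
  end.

Definition segment (a b : R * R) : set (R * R) :=
  [set z | exists2 t : R, 0 <= t <= 1 &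
     z = (a.1 + t * (b.1 - a.1), a.2 + t * (b.2 - a.2))].

Lemma segment_sym a b : segment a b = segment b a.
Proof.
have sub c d : segment c d `<=` segment d c.
  move=> z [t t01 ->]; exists (1 - t); first by lra.
  by congr pair; ring.
by apply/seteqP; split; apply: sub.
Qed.

Lemma segment_arc a b : a != b -> is_arc a b (segment a b).
Proof.
move=> ab; exists (fun t => (a.1 + t * (b.1 - a.1), a.2 + t * (b.2 - a.2))); split.
- apply: continuous_subspaceT => t.
  have lin (u v : R) : (fun s : R => u + s * v) @ t --> u + t * v.
    by apply: cvgD; [exact: cvg_cst|apply: cvgMl; exact: cvg_id].
  exact: (cvg_pair (lin a.1 (b.1 - a.1)) (lin a.2 (b.2 - a.2))).
- move=> s t _ _ [] /addrI e1 /addrI e2; apply/eqP; apply: contraNT ab => st.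
  have e (u v : R) : s * (v - u) = t * (v - u) -> u = v.
    move=> /eqP; rewrite -subr_eq0 -mulrBl mulf_eq0 !subr_eq0 (negbTE st) /=.
    by move=> /eqP.
  by rewrite [a]surjective_pairing [b]surjective_pairing (e _ _ e1) (e _ _ e2).
- by rewrite !mul0r !addr0 -surjective_pairing.
- by rewrite !mul1r !addrA ![_ + b.1]addrC ![_ + b.2]addrC !addrK -surjective_pairing.
- by apply/seteqP; split=> z [t t01 e]; exists t; rewrite ?in_itv //= in t01 *.
Qed.

Definition on_site_edge p q z : Prop :=
  match p, q with
  | Top, Bot => z.1 = 0 /\ -1 <= z.2 <= 1
  | Top, Axis i => z.1 = i.+1%:R * (1 - z.2) /\ 0 <= z.2 <= 1
  | Bot, Axis i => z.1 = i.+1%:R * (1 + z.2) /\ -1 <= z.2 <= 0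
  | FarTop, FarAxis i => z.1 = -1 - i.+1%:R * (1 - z.2) /\ 0 <= z.2 <= 1
  | Axis i, Axis _ => z.2 = 0 /\ i.+1%:R <= z.1 <= i.+1%:R + 1
  | _, _ => False
  end.

Lemma site_edgeP p q z : site_edge p q -> segment (coord p) (coord q) z -> on_site_edge p q z.
Proof.
case: p => [|||i|i|i|i]; case: q => [|||j|j|j|j] //= e [t t01 ->] /=.
- by split; lra.
- by split; [ring|lra].
- by split; [ring|lra].
- by rewrite -[j.+2]addn1 natrD; split; [ring|lra].
- by move/eqP: e => ->; rewrite -[i.+2]addn1 natrD; split; [ring|lra].
Qed.

Lemma nat_gap (i j : nat) : (i < j)%N -> i%:R + 1 <= j%:R :> R.
Proof. by move=> ij; rewrite -[1]/(1%:R) -natrD ler_nat addn1. Qed.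

Lemma low_bounds i : 0 < (2 * i.+2%:R : R)^-1 <= 1 / 4.
Proof.
have h : 2 <= i.+2%:R :> R by rewrite ler_nat.
rewrite invr_gt0; apply/andP; split; first by lra.
rewrite -[1 / 4]/(1 / 4); have -> : 1 / 4 = (4 : R)^-1 by rewrite mul1r.
by rewrite lef_pV2 ?posrE; lra.
Qed.

Lemma coord_inj : injective coord.
Proof.
have P k : 0 < k.+1%:R :> R by rewrite ltr0n.
have L k := low_bounds k.
move=> p q e; have e1 := congr1 fst e; have e2 := congr1 snd e; move: e1 e2 {e}.
case: p => [|||i|i|i|i]; case: q => [|||j|j|j|j] //= e1 e2;
  try by exfalso; move: e1 e2; try move: (P i) (P i.+1) (L i);
     try move: (P j) (P j.+1) (L j); lra.
- by move/eqP: e1; rewrite eqr_nat => /eqP[->].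
- by move/oppr_inj/eqP: e1; rewrite eqr_nat => /eqP[->].
- have /eqP : (2 * i + 1)%:R = (2 * j + 1)%:R :> R by lra.
  by rewrite eqr_nat => /eqP h'; congr Wedge; lia.
- move/addrI/invr_inj: e1 => e1; have /eqP : i.+2%:R = j.+2%:R :> R by lra.
  by rewrite eqr_nat => /eqP[->].
Qed.

Lemma site_edge_vertex p q r : site_edge p q -> on_site_edge p q (coord r) -> r = p \/ r = q.
Proof.
have P k : 0 < k.+1%:R :> R by rewrite ltr0n.
have L k := low_bounds k.
have S k : k.+2%:R = k.+1%:R + 1 :> R by rewrite -[k.+2]addn1 natrD.
have eqn k l : k%:R = l%:R :> R -> k = l by move/eqP; rewrite eqr_nat => /eqP.
have W k : (2 * k + 1)%:R = 2 * k%:R + 1 :> R by rewrite natrD natrM.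
have Sn k : k.+1%:R = k%:R + 1 :> R by rewrite -addn1 natrD.
have P0 k : 0 <= k%:R :> R by [].
case: p => [|||i|i|i|i]; case: q => [|||j|j|j|j] //= e;
  case: r => [|||k|k|k|k] /= [h1 h2]; try (by left); try (by right);
  try by exfalso; move: h1 h2; try move: (P i) (P i.+1);
     try move: (P j) (P j.+1); try move: (P k) (P k.+1) (L k); lra.
all: try (by right; congr Axis; apply: eqn; lra).
- by exfalso; rewrite W in h1; move: (P0 k); lra.
- by exfalso; move: (L k) h1; set w := _^-1; lra.
- exfalso; rewrite W (Sn j) in h1.
  have /eqn : (2 * k + 1)%:R = (2 * j.+1)%:R :> R by rewrite W natrM (Sn j); lra.
  by lia.
- exfalso; move: (L k) h1; set w := _^-1; rewrite (Sn j); case: j => [|j]; first by lra.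
  by have := ler1n R j.+1; rewrite ltn0Sn; lra.
- by right; congr FarAxis; apply/eq_add_S/eqn; move: h1; rewrite (S k); lra.
- move: h2; rewrite -(S i) !ler_nat !ltnS => /andP[ik ki].
  have [->|ne] := eqVneq k i; first by left.
  by right; congr Axis; lia.
Qed.

Lemma site_edge_cross p q p' q' z : site_edge p q -> site_edge p' q' ->
  on_site_edge p q z -> on_site_edge p' q' z ->
  (p = p' /\ q = q') \/
  exists r, [/\ r = p \/ r = q, r = p' \/ r = q' & z = coord r].
Proof.
have P k : 0 < k.+1%:R :> R by rewrite ltr0n.
have S k : k.+2%:R = k.+1%:R + 1 :> R by rewrite -[k.+2]addn1 natrD.
have eqn k l : k.+1%:R = l.+1%:R :> R -> k = l by move/eqP; rewrite eqr_nat => /eqP[].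
case: z => x y.
have top : x = 0 -> y = 1 -> (x, y) = coord Top by move=> -> ->.
have bot : x = 0 -> y = -1 -> (x, y) = coord Bot by move=> -> ->.
have far : x = -1 -> y = 1 -> (x, y) = coord FarTop by move=> -> ->.
have axis k : x = k.+1%:R -> y = 0 -> (x, y) = coord (Axis k) by move=> -> ->.
have z0 k (u : R) : k.+1%:R * u = 0 -> u = 0.
  by move/eqP; rewrite mulf_eq0 gt_eqF //= => /eqP.
have zz k l (u : R) : k.+1%:R * u = l.+1%:R * u -> k = l \/ u = 0.
  have [->|u0] := eqVneq u 0; first by right.
  by move=> /(mulIf u0) /eqn; left.
have near k l : k.+1%:R <= x <= k.+1%:R + 1 -> x = l.+1%:R -> l = k \/ l = k.+1.
  by move=> + h; rewrite h -S !ler_nat; lia.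
case: p => [|||i|i|i|i]; case: q => [|||j|j|j|j] //= e;
case: p' => [|||k|k|k|k]; case: q' => [|||l|l|l|l] //= e' [h1 h2] [h3 h4];
  try (by left);
  try (by exfalso; move: h1 h2 h3 h4; try move: (P i); try move: (P j);
     try move: (P k); try move: (P l); nra).
- right; exists Top; split; [by left|by left|].
  by apply: top => //; have := z0 l (1 - y); rewrite -h3 h1; lra.
- right; exists Bot; split; [by right|by left|].
  by apply: bot => //; have := z0 l (1 + y); rewrite -h3 h1; lra.
- right; exists Top; split; [by left|by left|].
  by apply: top => //; have := z0 j (1 - y); rewrite -h1 h3; lra.
- have [->|y1] := zz j l (1 - y) (etrans (esym h1) h3); first by left.
  right; exists Top; split; [by left|by left|].
  by apply: top; [rewrite h1 y1 mulr0|lra].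
- have y0 : y = 0 by lra.
  have jl : j = l by apply: eqn; rewrite y0 in h1 h3; lra.
  by right; exists (Axis j); split; [right|right; rewrite jl|apply: axis; rewrite // h1 y0 subr0 mulr1].
- have x1 : x = j.+1%:R by rewrite h1 h3 subr0 mulr1.
  right; exists (Axis j); split; [by right| |exact: axis].
  have [->|->] := near k j h4 x1; first by left.
  by right; rewrite (eqP e').
- right; exists Bot; split; [by left|by right|].
  by apply: bot => //; have := z0 j (1 + y); rewrite -h1 h3; lra.
- have y0 : y = 0 by lra.
  have jl : j = l by apply: eqn; rewrite y0 in h1 h3; lra.
  by right; exists (Axis j); split; [right|right; rewrite jl|apply: axis; rewrite // h1 y0 addr0 mulr1].
- have [->|y1] := zz j l (1 + y) (etrans (esym h1) h3); first by left.
  right; exists Bot; split; [by left|by left|].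
  by apply: bot; [rewrite h1 y1 mulr0|lra].
- have x1 : x = j.+1%:R by rewrite h1 h3 addr0 mulr1.
  right; exists (Axis j); split; [by right| |exact: axis].
  have [->|->] := near k j h4 x1; first by left.
  by right; rewrite (eqP e').
- have [|->|y1] := zz j l (1 - y); [lra|by left|].
  right; exists FarTop; split; [by left|by left|].
  by apply: far; [rewrite h1 y1 mulr0|]; lra.
- have x1 : x = l.+1%:R by rewrite h3 h1 subr0 mulr1.
  right; exists (Axis l); split; [|by right|exact: axis].
  have [->|->] := near i l h2 x1; first by left.
  by right; rewrite (eqP e).
- have x1 : x = l.+1%:R by rewrite h3 h1 addr0 mulr1.
  right; exists (Axis l); split; [|by right|exact: axis].
  have [->|->] := near i l h2 x1; first by left.
  by right; rewrite (eqP e).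
- rewrite (eqP e) (eqP e'); have [ik|ki|->] := ltngtP i k; last by left.
    have g := nat_gap ik; rewrite -[i.+1]addn1 -[k.+1]addn1 !natrD in g h2 h4.
    have e1 : x = k.+1%:R by rewrite -[k.+1]addn1 natrD; lra.
    right; exists (Axis k); split; [right|by left|exact: axis].
    by congr Axis; apply: eqn; rewrite -e1 -[i.+2]addn1 natrD -[i.+1]addn1 natrD; lra.
  have g := nat_gap ki; rewrite -[i.+1]addn1 -[k.+1]addn1 !natrD in g h2 h4.
  have e1 : x = i.+1%:R by rewrite -[i.+1]addn1 natrD; lra.
  right; exists (Axis i); split; [by left|right|exact: axis].
  by congr Axis; apply: eqn; rewrite -e1 -[k.+2]addn1 natrD -[k.+1]addn1 natrD; lra.
Qed.
End Sites.

Section SymGraph.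
Variable V : finType.

Definition sym_rel (r : rel V) : rel V := fun x y => (x != y) && (r x y || r y x).

Lemma sym_rel_sym r : symmetric (sym_rel r).
Proof. by move=> x y; rewrite /sym_rel eq_sym orbC. Qed.

Lemma sym_rel_irr r : irreflexive (sym_rel r).
Proof. by move=> x; rewrite /sym_rel eqxx. Qed.

Definition sym_graph r : sgraph V := SGraph (sym_rel_sym r) (sym_rel_irr r).
End SymGraph.

Section SiteDrawing.
Variables (R : realType) (V : finType) (r : rel V) (place : V -> site).
Hypothesis place_inj : injective place.
Hypothesis r_site : forall u v, r u v -> site_edge (place u) (place v).

Let pt v : R * R := coord R (place v).

Definition site_arc (e : {set V}) : set (R * R) :=
  [set z | exists u v, [/\ e = [set u; v]%SET, sym_graph r u v & segment (pt u) (pt v) z]].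

Lemma site_arcE u v : sym_graph r u v -> site_arc [set u; v]%SET = segment (pt u) (pt v).
Proof.
move=> ruv; apply/seteqP; split=> [z [a [b [/set2_inj[[-> ->]|[-> ->]] _ //]]]|z h].
  by rewrite segment_sym.
by exists u, v.
Qed.

Lemma site_orient u v : sym_graph r u v -> exists a b, [/\ [set u; v]%SET = [set a; b]%SET,
  site_edge (place a) (place b) & segment (pt u) (pt v) `<=` on_site_edge (place a) (place b)].
Proof.
case/andP=> _ /orP[] /r_site h.
  by exists u, v; split=> // z; exact: site_edgeP.
exists v, u; rewrite finset.setUC segment_sym; split=> // z; exact: site_edgeP.
Qed.

Lemma site_drawing : plane_drawing (sym_graph r) pt site_arc.
Proof.
have pt_inj : injective pt by move=> u v /coord_inj/place_inj.
split => //.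
- move=> u v ruv; rewrite site_arcE //; apply: segment_arc.
  by case/andP: ruv => uv _; apply: contra uv => /eqP/pt_inj->.
- move=> e0 w /imsetP[[u v]]; rewrite inE => /= ruv ->; rewrite site_arcE // => zw.
  have [a [b [-> ab sub]]] := site_orient ruv.
  by have [/place_inj->|/place_inj->] := site_edge_vertex ab (sub _ zw); rewrite !inE eqxx ?orbT.
- move=> e1 e2 /imsetP[[u v]]; rewrite inE => /= ruv -> /imsetP[[u' v']]; rewrite inE => /= ruv' -> ne z.
  rewrite !site_arcE // => h h'.
  have [a [b [e ab sub]]] := site_orient ruv; have [a' [b' [e' ab' sub']]] := site_orient ruv'.
  rewrite e e' in ne *.
  have [[/place_inj ea /place_inj eb]|[s [s1 s2 ->]]] := site_edge_cross ab ab' (sub _ h) (sub' _ h').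
    by rewrite ea eb eqxx in ne.
  case: s1 => es; [exists a|exists b]; rewrite /pt -es !inE eqxx ?orbT; split=> //;
    by case: s2; rewrite es => /place_inj->; rewrite eqxx ?orbT.
Qed.

Definition site_plane_graph : plane_graph R V := PlaneGraph site_drawing.
End SiteDrawing.

(** * Counting along injective homomorphisms *)

Section Morphism.
Variables (V : finType) (f : V -> V).
Hypothesis f_inj : injective f.

Lemma deg_hom (E E' : rel V) x : (forall y, E x y -> E' (f x) (f y)) ->
  (deg E x <= deg E' (f x))%N.
Proof.
move=> h; rewrite /deg -(card_imset _ f_inj); apply: subset_leq_card.
by apply/fintype.subsetP => z /imsetP[y]; rewrite !inE => /h ? ->.
Qed.

Lemma arcs_hom (E E' : rel V) : (forall x y, E x y -> E' (f x) (f y)) ->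
  (arcs E <= arcs E')%N.
Proof.
move=> h; rewrite {2}/arcs (reindex_inj f_inj); apply: leq_sum => x _.
by apply: deg_hom => y; exact: h.
Qed.
End Morphism.

Lemma subset_of_card (V : finType) (A : {set V}) k : (k <= #|A|)%N ->
  exists2 B : {set V}, B \subset A & #|B| = k.
Proof.
elim: k => [_|k IH kA]; first by exists finset.set0; rewrite ?finset.sub0set ?cards0.
have [B BA cB] := IH (ltnW kA).
have /properP[_ [x xA xB]] : B \proper A by rewrite properEcard BA cB.
exists (x |: B); last by rewrite cardsU1 xB cB.
by apply/fintype.subsetP => y; rewrite !inE => /orP[/eqP->//|]; exact: fintype.subsetP BA y.
Qed.

(** * Long cycles *)

Section Peeling.
Variables (R : realType) (V : finType).
Implicit Types (E : rel V) (A B : {set V}).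
Local Open Scope nat_scope.

Definition induced A E : rel V := fun x y => [&& x \in A, y \in A & E x y].

Lemma induced_sym A E : symmetric E -> symmetric (induced A E).
Proof. by move=> sE x y; rewrite /induced sE andbCA. Qed.

Lemma induced_irr A E : irreflexive E -> irreflexive (induced A E).
Proof. by move=> iE x; rewrite /induced iE !andbF. Qed.

Lemma induced_supported A E : supported (induced A E) A.
Proof. by move=> x y /and3P[]. Qed.

Lemma induced_sub A E x y : induced A E x y -> E x y.
Proof. by case/and3P. Qed.

Lemma del_vertex_induced A E v x y :
  induced (A :\ v) E x y = del_vertex v (induced A E) x y.
Proof.
rewrite /induced /del_vertex !inE; do ![case: (_ != _)]; rewrite //= ?andbF //.
Qed.

Lemma eq_arcs E E' : E =2 E' -> arcs E = arcs E'.
Proof. by move=> h; apply/eqP; rewrite eqn_leq !arcs_le // => x y; rewrite h. Qed.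

Lemma peel E A j : symmetric E -> irreflexive E -> weakly_planar R E -> j + 3 <= #|A| ->
  exists B, [/\ B \subset A, #|B| = #|A| - j & arcs (induced A E) <= arcs (induced B E) + 10 * j].
Proof.
move=> sE iE wE; elim: j => [_|j IH jA]; first by exists A; rewrite subn0 muln0 addn0.
have [|B [BA cB lB]] := IH; first by lia.
have wB : weakly_planar R (induced B E) by apply: weakly_planar_sub wE; exact: induced_sub.
have B3 : 3 <= #|B| by lia.
have bound := arcs_bound (induced_sym B sE) (induced_irr B iE) (@induced_supported B E) wB B3.
have [v vB dv] : exists2 v, v \in B & deg (induced B E) v <= 5.
  by apply: low_degree_vertex (@induced_supported B E) _; lia.
exists (B :\ v); split.
- exact: fintype.subset_trans (subD1set _ _) BA.
- by have := cardsD1 v B; rewrite vB; lia.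
- rewrite (eq_arcs (@del_vertex_induced B E v)).
  by have := arcs_del_vertex v (induced_sym B sE) (induced_irr B iE); lia.
Qed.

Lemma long_cycle_from_path E x p : uniq (x :: p) -> path E x p -> symmetric E ->
  (forall y, E x y -> y \in p) -> 2 <= deg E x ->
  exists c, [/\ uniq c, 3 <= size c & cycle E c].
Proof.
case: p => [|y p]; first by move=> _ _ _ h d2; exfalso; move: d2; rewrite leqNgt ltnS;
  rewrite (_ : deg E x = 0) //; apply: eq_card0 => y; rewrite inE; apply/negP => /h.
move=> un pa sE nb d2.
have [z Exz zy] : exists2 z, E x z & z != y.
  move: d2; rewrite /deg (cardsD1 y) => d2.
  have : 0 < #|[set z | E x z]%SET :\ y| by move: d2; case: (y \in _) => /=; lia.
  by case/card_gt0P=> z; rewrite !inE => /andP[zy Exz]; exists z.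
have zp : z \in p by have := nb _ Exz; rewrite inE (negbTE zy).
case/splitPr: zp un pa {nb} => p1 p2 un pa.
exists (x :: y :: rcons p1 z); split.
- by move: un; rewrite -cat_rcons -!cat_cons cat_uniq => /andP[].
- by rewrite /= size_rcons; lia.
- move: pa => /=; rewrite -cat_rcons cat_path => /and3P[-> pa _].
  by rewrite /= rcons_path pa last_rcons sE Exz.
Qed.

(** The end of a longest path has all its neighbours on the path. *)
Lemma min_degree_cycle E A : symmetric E -> irreflexive E -> supported E A -> A != finset.set0 ->
  (forall x, x \in A -> 2 <= deg E x) -> exists c, [/\ uniq c, 3 <= size c & cycle E c].
Proof.
move=> sE iE sup /set0Pn[x0 x0A] d2.
pose P k := [exists t : k.-tuple V, [exists x, uniq (x :: t) && path E x t && (x \in A)]].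
have P0 : P 0 by apply/existsP; exists [tuple]; apply/existsP; exists x0.
have Pb k : P k -> k <= #|V|.
  move=> /existsP[t /existsP[x /andP[/andP[un _] _]]].
  by have := max_card (mem (x :: t)); rewrite (card_uniqP un) /= size_tuple; lia.
case: (@ex_maxnP P #|V| (ex_intro _ 0 P0) Pb) => k /existsP[t /existsP[x]].
case/andP=> /andP[un pa] xA maxk.
apply: (long_cycle_from_path un pa sE) => [y Exy|]; last exact: d2.
apply: contraT => yt.
have yx : y != x by apply: contraTneq Exy => ->; rewrite iE.
suff /maxk : P k.+1 by rewrite ltnn.
have yA : y \in A by apply: (sup y x); rewrite sE.
apply/existsP; exists (cons_tuple x t); apply/existsP; exists y; rewrite yA andbT.
have -> : path E y (cons_tuple x t) by rewrite /= sE Exy pa.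
by rewrite andbT cons_uniq un andbT inE negb_or yx yt.
Qed.

(** Deleting a vertex of degree at most one loses at most two arcs, so the hypothesis is inherited
    until all degrees are at least two. *)
Lemma exists_cycle E A : symmetric E -> irreflexive E -> supported E A -> A != finset.set0 ->
  2 * #|A| <= arcs E -> exists c, [/\ uniq c, 3 <= size c & cycle E c].
Proof.
have [n] := ubnP #|A|; elim: n => // n IH in E A * => lt sE iE sup A0 big.
have [/forall_inP d2|] := boolP [forall x in A, 2 <= deg E x].
  exact: (min_degree_cycle sE iE sup A0 d2).
rewrite negb_forall => /existsP[x]; rewrite negb_imply -ltnNge => /andP[xA dx].
have cA := cardsD1 x A; rewrite xA in cA.
have aE := arcs_del_vertex x sE iE.
have [e|A'0] := eqVneq (A :\ x) finset.set0.
  rewrite e cards0 in cA.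
  have := deg_supported sE iE sup xA; rewrite cA /= leqn0 => /eqP d0.
  by move: big; rewrite (arcs_supported sup) (big_setD1 x) //= e big_set0 d0 cA.
have [||||||c [uc sc cc]] := IH (del_vertex x E) (A :\ x).
- by lia.
- exact: del_vertex_sym.
- exact: del_vertex_irr.
- by move=> a b /and3P[ax _ /sup aA]; rewrite !inE ax.
- exact: A'0.
- by lia.
exists c; split => //.
by apply: sub_cycle cc => a b /and3P[].
Qed.
End Peeling.

(** * A single vertex of large degree *)

Section Triangles.
Variable R : realType.
Implicit Types (z : R * R).

Definition affine (a b c : R) z : R := a + b * z.1 + c * z.2.

Lemma affine_continuous a b c : continuous (affine a b c).
Proof.
move=> z; apply: cvgD; first apply: cvgD; first exact: cvg_cst.
  by apply: cvgMr; exact: cvg_fst.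
by apply: cvgMr; exact: cvg_snd.
Qed.

(** For affine functions that cut out a triangle, this is positive inside, zero exactly on the
    boundary and negative outside. *)
Definition min3 (f g h : R * R -> R) z : R := Num.min (f z) (Num.min (g z) (h z)).

Lemma min3_continuous f g h : continuous f -> continuous g -> continuous h ->
  continuous (min3 f g h).
Proof.
move=> cf cg ch z.
apply: (@continuous_min R (R * R)%type f (g \min h) z (cf z)).
exact: (@continuous_min R (R * R)%type g h z (cg z) (ch z)).
Qed.

Lemma min3_gt0 f g h z : (0 < min3 f g h z) = [&& 0 < f z, 0 < g z & 0 < h z].
Proof. by rewrite /min3 !lt_min. Qed.

Lemma min3_ge0 f g h z : (0 <= min3 f g h z) = [&& 0 <= f z, 0 <= g z & 0 <= h z].
Proof. by rewrite /min3 !le_min. Qed.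

Lemma min3_eq0 f g h z : min3 f g h z = 0 ->
  [/\ 0 <= f z, 0 <= g z, 0 <= h z & [\/ f z = 0, g z = 0 | h z = 0]].
Proof.
move=> e; have := min3_ge0 f g h z; rewrite e lexx => /esym/and3P[h1 h2 h3]; split=> //.
have := min3_gt0 f g h z; rewrite e ltxx => /esym/negbT; rewrite !negb_and -!leNgt.
by case/or3P=> h4; [apply: Or31|apply: Or32|apply: Or33]; lra.
Qed.

Lemma segmentP (a b z : R * R) t : 0 <= t <= 1 ->
  z.1 = a.1 + t * (b.1 - a.1) -> z.2 = a.2 + t * (b.2 - a.2) -> segment a b z.
Proof. by move=> t01 e1 e2; exists t => //; rewrite -e1 -e2 -surjective_pairing. Qed.

Lemma segment_top_bot z : z.1 = 0 -> -1 <= z.2 <= 1 -> segment (coord R Top) (coord R Bot) z.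
Proof. by move=> e h; apply: (@segmentP _ _ _ ((1 - z.2) / 2)) => /=; lra. Qed.

Lemma segment_top_axis i z : z.1 = i.+1%:R * (1 - z.2) -> 0 <= z.2 <= 1 ->
  segment (coord R Top) (coord R (Axis i)) z.
Proof. by move=> e h; apply: (@segmentP _ _ _ (1 - z.2)) => /=; [lra|rewrite e; ring|lra]. Qed.

Lemma segment_bot_axis i z : z.1 = i.+1%:R * (1 + z.2) -> -1 <= z.2 <= 0 ->
  segment (coord R Bot) (coord R (Axis i)) z.
Proof. by move=> e h; apply: (@segmentP _ _ _ (1 + z.2)) => /=; [lra|rewrite e; ring|lra]. Qed.

Lemma segment_axis i z : z.2 = 0 -> i.+1%:R <= z.1 <= i.+2%:R ->
  segment (coord R (Axis i)) (coord R (Axis i.+1)) z.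
Proof.
have S : i.+2%:R = i.+1%:R + 1 :> R by rewrite -[i.+2]addn1 natrD.
by rewrite S => e h; apply: (@segmentP _ _ _ (z.1 - i.+1%:R)) => /=; rewrite ?S; lra.
Qed.

Lemma axis_interval z m : z.2 = 0 -> 1 <= z.1 -> z.1 <= m.+1%:R -> (0 < m)%N ->
  exists2 i, (i < m)%N & segment (coord R (Axis i)) (coord R (Axis i.+1)) z.
Proof.
move=> z2 z1; elim: m => // m IH zm _.
have [zm'|mz] := lerP z.1 m.+1%:R; last first.
  by exists m => //; apply: segment_axis => //; rewrite (ltW mz).
have [m0|m0] := posnP m; last by have [i im seg] := IH zm' m0; exists i => //; lia.
by exists 0%N => //; rewrite m0 in zm zm'; apply: segment_axis => //; rewrite z1.
Qed.
End Triangles.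

Lemma index_injective (T : eqType) (s : seq T) u v :
  u \in s -> v \in s -> index u s = index v s -> u = v.
Proof. by move=> us vs e; rewrite -(nth_index u us) e nth_index. Qed.

Lemma deg_lt_card (V : finType) (E : rel V) x : irreflexive E -> (deg E x < #|V|)%N.
Proof.
move=> iE; rewrite -cardsT (cardsD1 x) inE ltnS; apply: subset_leq_card.
by apply/fintype.subsetP => y; rewrite !inE andbT; apply: contraTneq => ->; rewrite iE.
Qed.

Lemma saturated_site_extension (R : realType) (V : finType) (G : sgraph V) (r : rel V)
    (place : V -> site) : injective place ->
  (forall u v, r u v -> site_edge (place u) (place v)) -> (forall u v, r u v -> G u v) ->
  exists H : plane_graph R V, [/\ plane_saturated_subgraph H G,
    forall u v, r u v -> H u v, forall v, pg_pt H v = coord R (place v) &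
    forall u v, r u v ->
      pg_arc H [set u; v]%SET = segment (coord R (place u)) (coord R (place v))].
Proof.
move=> place_inj r_site r_sub; pose H0 := site_plane_graph R place_inj r_site.
have rH0 u v : r u v -> H0 u v.
  move=> ruv; rewrite /= /sym_rel ruv andbT; apply: contraTneq (r_site _ _ ruv) => ->.
  by case: (place v) => //= i; lia.
have iso0 : iso_to_subgraph H0 G.
  by exists id => // u v /andP[_ /orP[/r_sub //|/r_sub]]; rewrite adj_sym.
have [H [sat sub ept earc]] := saturation iso0.
exists H; split=> // [u v /rH0/sub //|v|u v /rH0 ruv]; first by rewrite ept.
by rewrite earc //; apply: site_arcE.
Qed.

Section HubCase.
Variables (R : realType) (V : finType) (G : sgraph V).

Section Place.
Variables (x b : V) (s : seq V).

Definition hub_place v : site :=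
  if v == x then Top else if v == b then Bot else
  if v \in s then Axis (index v s) else Low (index v (enum V)).

Lemma hub_place_inj : injective hub_place.
Proof.
move=> u v; rewrite /hub_place.
case: (eqVneq u x) => [->|_]; case: (eqVneq v x) => [->|_] //; do ?by do !case: ifP.
case: (eqVneq u b) => [->|_]; case: (eqVneq v b) => [->|_] //; do ?by do !case: ifP.
case: ifP => us; case: ifP => vs // [].
  exact: index_injective.
by apply: index_injective; rewrite mem_enum.
Qed.
End Place.

(** Only the edges from [x] to the [2k] vertices of [I] are left out, so [x] keeps degree at least
    [d - 2k] and every embedding fixes it. Then [H - x] has no more edges than [G - x], and [x] has
    degree at most [n - 1 - 2k] in [H]. As [n - 1 - d < k], more than [k] edges are saved. *)
Lemma hub_case x d k : deg G x = d -> (forall v, v != x -> deg G v + 2 * k < d)%N ->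
  weakly_planar R G -> (#|V| <= d + k)%N -> (3 * #|V| <= num_edges G + 5 + k)%N ->
  (13 * k + 78 <= #|V|)%N ->
  exists H : plane_graph R V, plane_saturated_subgraph H G /\
    (num_edges H + 6 + k <= 3 * #|V|)%N.
Proof.
move=> dx second wG nd big kn; set n := #|V| in nd big kn *.
have sG := adj_sym G; have iG := adj_irr G.
have eG := double_num_edges G.
have n3 : (3 <= n)%N by lia.
have Gub := plane_edge_bound wG n3.
have dn : (d < n)%N.
  rewrite -dx; exact: deg_lt_card.
have aG := arcs_del_vertex x sG iG.
pose A : {set V} := [set~ x]%SET.
have cA : #|A| = n.-1 by rewrite cardsC1.
have delA : del_vertex x G =2 induced A G by move=> a c; rewrite /del_vertex /induced !inE.
have [|B [BA cB lB]] := @peel R V G A (2 * k) sG iG wG; first by rewrite cA; lia.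
rewrite -(eq_arcs delA) in lB.
have [||c [uc st cyc]] := exists_cycle (induced_sym B sG) (induced_irr B iG) (@induced_supported _ B G).
- by rewrite -card_gt0 cB cA; lia.
- by rewrite cB cA; lia.
case: c uc st cyc => // b t uc st cyc.
have {}st : (2 <= size t)%N by move: st; rewrite /= ltnS.
have t0 : (0 < size t)%N by lia.
have edge_t i : (i <= size t)%N -> induced B G (nth b (b :: t) i) (nth b (rcons t b) i).
  move=> it; have /(pathP b) := cyc; rewrite size_rcons => /(_ i).
  by rewrite -rcons_cons nth_rcons /= ltnS it; apply.
have tB v : v \in t -> v \in B.
  move=> vt; have := edge_t (index v t); rewrite index_size => /(_ isT) /and3P[_ + _].
  by rewrite nth_rcons index_mem vt nth_index.
have bB : b \in B by have /and3P[] := edge_t 0%N isT.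
have xB : x \notin B by apply/negP => /(fintype.subsetP BA); rewrite !inE eqxx.
have neB v : v \in B -> v != x by apply: contraTneq => ->.
pose I := A :\: B.
have cI : #|I| = (2 * k)%N by rewrite cardsDS // cB cA; lia.
have xI : x \notin I by rewrite !inE eqxx andbF.
(* The cycle comes first, so its vertices get consecutive places on the axis. Repetitions are
   harmless because [index] finds the first occurrence. *)
pose s := t ++ enum B.
have sB v : (v \in s) = (v \in B).
  by rewrite mem_cat mem_enum; case: (boolP (v \in t)) => // /tB->.
pose place := hub_place x b s.
have place_inj : injective place by exact: hub_place_inj.
have [bt ut] : b \notin t /\ uniq t by move: uc => /= /andP[].
have place_x : place x = Top by rewrite /place /hub_place eqxx.
have place_b : place b = Bot by rewrite /place /hub_place (negbTE (neB _ bB)) eqxx.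
have place_t v : v \in t -> place v = Axis (index v t).
  move=> vt; rewrite /place /hub_place (negbTE (neB _ (tB _ vt))) sB (tB _ vt).
  by rewrite ifN; [rewrite index_cat vt|apply: contraNneq bt => <-].
have place_B v : v \in B -> v != b -> exists i, place v = Axis i.
  by move=> vB vb; rewrite /place /hub_place (negbTE (neB _ vB)) (negbTE vb) sB vB; eexists.
have place_I v : v \in I -> exists i, place v = Low i.
  rewrite /place /hub_place !inE => /andP[vB vx]; rewrite (negbTE vx) sB (negbTE vB).
  by rewrite ifN; [eexists|apply: contraNneq vB => ->].
pose r u v := [|| (u == x) && (G x v && (v \notin I)),
   (u == b) && ((v == head b t) || (v == last b t)) |
   [&& u \in t, v \in t & index v t == (index u t).+1]].
have head_t : head b t \in t by rewrite -nth0 mem_nth.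
have last_t : last b t \in t by rewrite -nth_last mem_nth // prednK.
have r_site u v : r u v -> site_edge (place u) (place v).
  case/or3P.
  - case/andP=> /eqP-> /andP[Gxv vI]; rewrite place_x.
    have vx : v != x by apply: contraTneq Gxv => ->; rewrite iG.
    have vB : v \in B by move: vI; rewrite !inE vx andbT negbK.
    by have [->|vb] := eqVneq v b; [rewrite place_b|have [i ->] := place_B v vB vb].
  - by case/andP=> /eqP-> /orP[] /eqP->; rewrite place_b place_t.
  - by case/and3P=> ut' vt /eqP e; rewrite !place_t //= e.
have r_sub u v : r u v -> G u v.
  case/or3P.
  - by case/andP=> /eqP-> /andP[].
  - case/andP=> /eqP-> /orP[] /eqP->.
      by have /and3P[_ _] := edge_t 0%N isT; rewrite nth_rcons t0 nth0.
    have := edge_t (size t) (leqnn _); rewrite nth_rcons ltnn eqxx.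
    by case: (size t) t0 (nth_last b t) => // m _ /= -> /and3P[_ _]; rewrite sG.
  - case/and3P=> ut' vt /eqP e.
    have lt : (index v t < size t)%N by rewrite index_mem.
    have := edge_t _ (ltnW lt); rewrite nth_rcons lt nth_index // e /= nth_index //.
    by case/and3P.
have [H [sat sub ept earc]] := saturated_site_extension R place_inj r_site r_sub.
exists H; split=> //.
pose L : R := (size t)%:R.
have L2 : 2 <= L by rewrite ler_nat.
have noxI w : w \in I -> ~~ H w x.
  move=> wI; apply/negP => Hwx.
  (* The triangle spanned by [Bot] and the first and last places of [t]. Its boundary is the drawn
     cycle, and it contains all [Low] places since [t] has at least two elements. *)
  pose m := min3 (affine 0 0 (-1)) (affine (-1) 1 (-1)) (affine L (-1) L) : R * R -> R.
  pose curve := [set [set p.1; p.2]%SET | p : V * V & r p.1 p.2 && (p.1 != x)]%SET.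
  have curveP u v : r u v -> u != x -> [set u; v]%SET \in curve.
    by move=> ruv ux; apply/imsetP; exists (u, v); rewrite // inE ruv ux.
  have cm : continuous m by apply: min3_continuous; exact: affine_continuous.
  have curve_H : curve \subset edges H.
    by apply/fintype.subsetP => e /imsetP[[u v]]; rewrite inE /= => /andP[ruv _] ->; apply/edge_mem/sub.
  have cover z : m z = 0 -> exists2 e, e \in curve & pg_arc H e z.
    move=> mz; have [h1 h2 h3 h] := min3_eq0 mz; move: h1 h2 h3 h; rewrite /affine => h1 h2 h3.
    have y1 : 0 <= 1 + z.2 by nra.
    case=> h4.
    + have z2 : z.2 = 0 by lra.
      rewrite z2 in h2 h3; have [||||i im seg] := @axis_interval R z (size t).-1.
      * by [].
      * by lra.
      * by rewrite prednK // -/L; lra.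
      * by rewrite -ltnS prednK.
      have it' : (i.+1 < size t)%N by rewrite -[size t]prednK // ltnS.
      have it := ltnW it'.
      have ruv : r (nth b t i) (nth b t i.+1).
        by apply/or3P; apply: Or33; rewrite (mem_nth _ it) (mem_nth _ it') !index_uniq // eqxx.
      exists [set nth b t i; nth b t i.+1]%SET.
        by apply: curveP => //; apply/neB/tB/mem_nth.
      by rewrite earc // !place_t ?mem_nth // !index_uniq.
    + have ruv : r b (head b t) by apply/or3P; apply: Or32; rewrite !eqxx.
      exists [set b; head b t]%SET; first by apply: curveP => //; exact: neB.
      rewrite earc // place_b place_t // -nth0 index_uniq //.
      by apply: segment_bot_axis; lra.
    + have ruv : r b (last b t) by apply/or3P; apply: Or32; rewrite !eqxx ?orbT.
      exists [set b; last b t]%SET; first by apply: curveP => //; exact: neB.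
      rewrite earc // place_b place_t // -nth_last index_uniq ?prednK //.
      by apply: segment_bot_axis; rewrite ?prednK // -?/L; lra.
  have mw : 0 < m (pg_pt H w).
    have [i ei] := place_I _ wI; rewrite ept ei min3_gt0 /affine /=.
    by move: (low_bounds R i); set q := _^-1; nra.
  have mx : m (pg_pt H x) <= 0.
    by rewrite ept place_x leNgt min3_gt0 /affine /=; lra.
  have [e /imsetP[[u v]]] := separation cm curve_H cover Hwx mw mx.
  rewrite inE /= => /andP[ruv ux] ->; rewrite !inE => e'.
    have uB : u \in B.
      case/or3P: ruv => [/andP[/eqP uE]|/andP[/eqP->]|/and3P[/tB]] //.
      by rewrite uE eqxx in ux.
    have vB : v \in B.
      case/or3P: ruv => [/andP[/eqP uE]|/andP[_ /orP[] /eqP->]|/and3P[_ /tB]] //.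
      + by rewrite uE eqxx in ux.
      + exact: tB.
      + exact: tB.
    move: wI; rewrite !inE => /andP[wB wx].
    by case/orP: e' => /orP[] /eqP e'; move: wB xB; rewrite ?e' ?uB ?vB // -e' ?uB ?vB.
have [_ [f f_inj fG] _] := sat.
have sH := adj_sym H; have iH := adj_irr H.
have eH := double_num_edges H; have aH := arcs_del_vertex x sH iH.
have dH : (d <= deg H x + 2 * k)%N.
  rewrite -cI -dx; apply: leq_trans (leq_card_setU _ _); apply: subset_leq_card.
  apply/fintype.subsetP => v; rewrite inE => Gxv; rewrite finset.in_setU.
  case: (boolP (v \in I)) => vI; rewrite ?orbT // orbF inE sub //.
  by apply/or3P; apply: Or31; rewrite eqxx Gxv vI.
have fx : f x = x.
  apply/eqP; apply: contraT => /second.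
  by have := deg_hom f_inj (E := H) (E' := G) (fG x); clear -dH; lia.
have le_del : (arcs (del_vertex x H) <= arcs (del_vertex x G))%N.
  apply: (arcs_hom f_inj) => u v /and3P[ux vx /fG Guv].
  by rewrite /del_vertex -fx !(inj_eq f_inj) ux vx.
have degH : (deg H x + 2 * k < n)%N.
  have := cardsC (x |: I); rewrite cardsU1 xI cI -/n /= => <-.
  rewrite addnC add1n ltnS leq_add2l; apply: subset_leq_card.
  apply/fintype.subsetP => v; rewrite inE => Hxv; rewrite finset.in_setC finset.in_setU1 negb_or.
  apply/andP; split; first by apply: contraTneq Hxv => ->; rewrite iH.
  by apply: contraTN Hxv => /noxI; rewrite sH.
clear -dH le_del degH eH aH eG aG dx nd Gub; lia.
Qed.
End HubCase.

(** * Two vertices of large degree *)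

Section TwoHubCase.
Variables (R : realType) (V : finType) (G : sgraph V).

Lemma common_nbrs3 (E : rel V) a b c : irreflexive E -> weakly_planar R E ->
  a != b -> a != c -> b != c -> (#|[set v | [&& E a v, E b v & E c v]]%SET| <= 2)%N.
Proof.
move=> iE wE ab ac bc; rewrite leqNgt; apply/negP => /subset_of_card[S SC cS].
have SP v : v \in S -> [/\ E a v, E b v & E c v].
  by move=> /(fintype.subsetP SC); rewrite inE => /and3P.
have neS w v : v \in S -> w \in [:: a; b; c] -> w != v.
  move=> /SP[h1 h2 h3]; rewrite !inE => wE'; apply/eqP => ewv; subst w.
  by case/or3P: wE' => /eqP e; subst v; rewrite iE in h1 h2 h3.
apply: (@no_biclique3 R V E [:: a; b; c] (enum S) wE) => //; first by rewrite -cardE.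
  rewrite cat_uniq enum_uniq andbT /= !inE negb_or ab ac bc /=.
  by apply/hasPn => v; rewrite mem_enum => vS; apply/negP => vabc; have := neS v v vS vabc; rewrite eqxx.
move=> w v; rewrite mem_enum => wabc /SP[h1 h2 h3].
by move: wabc; rewrite !inE => /or3P[] /eqP->.
Qed.

Section Place.
Variables (x y b : V) (s : seq V).

Definition two_hub_place v : site :=
  if v == x then Top else if v == y then FarTop else if v == b then Bot else
  if v \in s then Axis (index v s) else FarAxis (index v (enum V)).

Lemma two_hub_place_inj : injective two_hub_place.
Proof.
move=> u v; rewrite /two_hub_place.
case: (eqVneq u x) => [->|_]; case: (eqVneq v x) => [->|_] //; do ?by do !case: ifP.
case: (eqVneq u y) => [->|_]; case: (eqVneq v y) => [->|_] //; do ?by do !case: ifP.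
case: (eqVneq u b) => [->|_]; case: (eqVneq v b) => [->|_] //; do ?by do !case: ifP.
case: ifP => us; case: ifP => vs // [].
  exact: index_injective.
by apply: index_injective; rewrite mem_enum.
Qed.
End Place.

Lemma two_hub_counts x y k d : deg G x = d -> y != x -> (d <= deg G y + 2 * k)%N ->
  weakly_planar R G -> (#|V| <= d + k)%N -> (3 * #|V| <= num_edges G + 5 + k)%N ->
  (13 * k + 78 <= #|V|)%N ->
  let C := [set v | G x v && G y v]%SET in
  [/\ (#|V| <= #|C| + 4 * k)%N,
      forall v, v != x -> v != y -> (deg G v <= 4 * k + 2)%N &
      exists c c', [/\ c \in C, c' \in C & G c c']].
Proof.
move=> dx yx dy wG nd big kn C; set n := #|V| in nd big kn *.
have sG := adj_sym G; have iG := adj_irr G; have eG := double_num_edges G.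
have cC : (n <= #|C| + 4 * k)%N.
  have := cardsUI [set v | G x v]%SET [set v | G y v]%SET.
  rewrite -/(deg G x) -/(deg G y) dx.
  have -> : ([set v | G x v] :&: [set v | G y v] = C)%SET by apply/finset.setP => v; rewrite !inE.
  have : (#|[set v | G x v] :|: [set v | G y v]|%SET <= n)%N by exact: max_card.
  by clear -dy nd; lia.
have nbrC v : v != x -> v != y -> (#|[set w in C | G v w]%SET| <= 2)%N.
  move=> vx vy; have xy : x != y by rewrite eq_sym.
  rewrite eq_sym in vx; rewrite eq_sym in vy.
  apply: leq_trans (common_nbrs3 iG wG xy vx vy); apply: subset_leq_card.
  by apply/fintype.subsetP => w; rewrite !inE -andbA.
pose F := (~: C)%SET.
have cF : (#|C| + #|F| = n)%N by rewrite cardsC.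
split=> //.
  move=> v vx vy.
  have : (deg G v <= #|[set w in C | G v w]%SET| + #|F|)%N.
    apply: leq_trans (leq_card_setU _ _); apply: subset_leq_card.
    by apply/fintype.subsetP => w; rewrite !inE => ->; rewrite andbT orbN.
  by have := nbrC v vx vy; lia.
(* Otherwise every edge lies inside [F] or joins [F] to [C], and only the two hubs can have more
   than two neighbours in [C]. *)
apply: contrapT => noedge.
have xF : x \in F by rewrite !inE iG.
have yF : y \in F by rewrite !inE iG andbF.
have noCC u v : u \in C -> v \in C -> G u v = false.
  by move=> uC vC; apply/negP => Guv; apply: noedge; exists u, v.
have yFx : y \in (F :\ x)%SET by rewrite finset.in_setD1 yx yF.
have cF2 : (2 <= #|F|)%N.
  by rewrite (cardsD1 x) xF (cardsD1 y) yFx.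
(* The constant is 10 instead of 12 because [F] may consist of the two hubs alone. *)
have aF : (arcs (induced F G) + 10 <= 6 * #|F|)%N.
  have [F3|F3] := leqP 3 #|F|.
    have wF : weakly_planar R (induced F G) by apply: weakly_planar_sub wG; exact: induced_sub.
    have := arcs_bound (induced_sym F sG) (induced_irr F iG) (@induced_supported V F G) wF F3; lia.
  rewrite (arcs_supported (@induced_supported V F G)).
  have : (\sum_(u in F) deg (induced F G) u <= \sum_(u in F) 1)%N.
    apply: leq_sum => u uF.
    have := deg_supported (induced_sym F sG) (induced_irr F iG) (@induced_supported V F G) uF; lia.
  by rewrite sum_nat_const; lia.
have cross : (arcs G <= arcs (induced F G) + 2 * \sum_(v in F) #|[set w in C | G v w]%SET|)%N.
  have card_sum v : #|[set w in C | G v w]%SET| = (\sum_w ((w \in C) && G v w))%N.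
    by rewrite -sum1_card big_mkcond /=; apply: eq_bigr => w _; rewrite !inE; case: ifP.
  have sumC : (\sum_(v in F) #|[set w in C | G v w]%SET| =
      \sum_u \sum_v (u \in F) * ((v \in C) && G u v))%N.
    rewrite [LHS]big_mkcond; apply: eq_bigr => v _; rewrite card_sum -big_distrr /=.
    by case: ifP; rewrite ?mul1n ?mul0n.
  have sumC' : (\sum_(v in F) #|[set w in C | G v w]%SET| =
      \sum_u \sum_v (v \in F) * ((u \in C) && G u v))%N.
    rewrite sumC exchange_big; apply: eq_bigr => v _; apply: eq_bigr => w _.
    by rewrite sG.
  rewrite mul2n -addnn {1}sumC sumC' !arcsE -!big_split; apply: leq_sum => u _.
  rewrite -!big_split; apply: leq_sum => v _ /=; rewrite /induced.
  have := noCC u v; rewrite /F !finset.in_setC.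
  case: (u \in C) (v \in C) (G u v) => [] [] [] //= h.
  by have := h isT isT.
have sumF : (\sum_(v in F) #|[set w in C | G v w]%SET| + 4 <= 2 * #|C| + 2 * #|F|)%N.
  have C_le v : (#|[set w in C | G v w]%SET| <= #|C|)%N.
    by apply: subset_leq_card; apply/fintype.subsetP => w; rewrite inE => /andP[].
  rewrite (big_setD1 x) //= (big_setD1 y) //=.
  have : (\sum_(v in F :\ x :\ y) #|[set w in C | G v w]%SET| <= \sum_(v in F :\ x :\ y) 2)%N.
    by apply: leq_sum => v; rewrite !inE => /and3P[vy vx _]; apply: nbrC.
  rewrite sum_nat_const; have := cardsD1 x F; have := cardsD1 y (F :\ x).
  rewrite xF yFx /= => e1 e2.
  have := C_le x; have := C_le y; clear -e1 e2; lia.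
clear -aF cross sumF eG big cC cF kn; lia.
Qed.

(** The number [4k + 3] exceeds the degrees in [G] of all other vertices. Drawing that many edges at
    each hub forces every embedding to preserve the pair of hubs, though it may exchange them. The
    [4k + 3] vertices of [I] drawn at [x] are also the ones that [y] cannot reach. *)
Lemma two_hub_case x y k d : deg G x = d -> (forall v, deg G v <= d)%N ->
  y != x -> (d <= deg G y + 2 * k)%N ->
  weakly_planar R G -> (#|V| <= d + k)%N -> (3 * #|V| <= num_edges G + 5 + k)%N ->
  (13 * k + 78 <= #|V|)%N ->
  exists H : plane_graph R V, plane_saturated_subgraph H G /\
    (num_edges H + 6 + k <= 3 * #|V|)%N.
Proof.
move=> dx maxd yx dy wG nd big kn.
have [] := two_hub_counts dx yx dy wG nd big kn.
set C := [set v | _]%SET; set n := #|V| in nd big kn *.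
move=> cC small [c [c' [cinC c'inC Gcc']]].
have sG := adj_sym G; have iG := adj_irr G; have eG := double_num_edges G.
have n3 : (3 <= n)%N by lia.
have Gub := plane_edge_bound wG n3.
have inC v : v \in C = G x v && G y v by rewrite inE.
have neG u v : G u v -> u != v by apply: contraTneq => ->; rewrite iG.
have neC v : v \in C -> (v != x) && (v != y).
  by rewrite inC => /andP[/neG h1 /neG h2]; rewrite eq_sym h1 eq_sym h2.
have cc' := neG _ _ Gcc'.
have cC2 : #|C :\ c :\ c'| = (#|C| - 2)%N.
  have e1 := cardsD1 c C; have e2 := cardsD1 c' (C :\ c).
  have c'C : c' \in C :\ c by rewrite finset.in_setD1 eq_sym cc' c'inC.
  by rewrite c'C in e2; rewrite cinC in e1; clear -e1 e2; lia.
have [|I IC cI] := @subset_of_card V (C :\ c :\ c') (4 * k + 3).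
  by rewrite cC2; clear -kn cC; lia.
pose J := (C :\ c :\ c') :\: I.
have cJ : (4 * k + 3 <= #|J|)%N by rewrite cardsDS // cC2 cI; clear -kn cC; lia.
have IP v : v \in I -> [/\ v \in C, v != c & v != c'].
  by move=> /(fintype.subsetP IC); rewrite !finset.in_setD1 => /and3P[-> -> ->].
have JP v : v \in J -> [/\ v \in C, v != c, v != c' & v \notin I].
  by rewrite finset.in_setD => /andP[-> ]; rewrite !finset.in_setD1 => /and3P[-> -> ->].
have c'I : c' \notin I by apply/negP => /IP[_ _]; rewrite eqxx.
pose s := rcons (enum I) c'.
pose place := two_hub_place x y c s.
have place_inj : injective place by exact: two_hub_place_inj.
have place_x : place x = Top by rewrite /place /two_hub_place eqxx.
have place_y : place y = FarTop by rewrite /place /two_hub_place (negbTE yx) eqxx.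
have place_c : place c = Bot.
  by have /andP[/negbTE h1 /negbTE h2] := neC _ cinC; rewrite /place /two_hub_place h1 h2 eqxx.
have place_c' : place c' = Axis #|I|.
  have /andP[/negbTE h1 /negbTE h2] := neC _ c'inC.
  rewrite /place /two_hub_place h1 h2 eq_sym (negbTE cc') /s mem_rcons mem_head.
  by rewrite -cats1 index_cat mem_enum (negbTE c'I) /= eqxx addn0 -cardE.
have place_I v : v \in I -> exists2 i, (i < #|I|)%N & place v = Axis i.
  move=> vI; have [vC vc vc'] := IP _ vI; have /andP[/negbTE h1 /negbTE h2] := neC _ vC.
  exists (index v (enum I)); first by rewrite cardE index_mem mem_enum.
  rewrite /place /two_hub_place h1 h2 (negbTE vc) /s mem_rcons inE (negbTE vc') mem_enum vI /=.
  by rewrite -cats1 index_cat mem_enum vI.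
have place_J v : v \in J -> exists i, place v = FarAxis i.
  move=> vJ; have [vC vc vc' vI] := JP _ vJ; have /andP[/negbTE h1 /negbTE h2] := neC _ vC.
  rewrite /place /two_hub_place h1 h2 (negbTE vc) /s mem_rcons inE (negbTE vc') mem_enum.
  by rewrite (negbTE vI) /=; eexists.
pose r u v := [|| (u == x) && [|| v == c, v == c' | v \in I], (u == c) && (v == c') |
   (u == y) && (v \in J)].
have r_site u v : r u v -> site_edge (place u) (place v).
  case/or3P => /andP[/eqP->].
  - case/or3P=> [/eqP->|/eqP->|/place_I[i _ ->]]; rewrite place_x ?place_c ?place_c' //.
  - by move/eqP->; rewrite place_c place_c'.
  - by move/place_J=> [i ->]; rewrite place_y.
have CP v : v \in C -> G x v /\ G y v by rewrite inC => /andP[].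
have r_sub u v : r u v -> G u v.
  case/or3P => /andP[/eqP->].
  - case/or3P=> [/eqP->|/eqP->|/IP[/CP[] //]]; first exact: (CP _ cinC).1.
    exact: (CP _ c'inC).1.
  - by move/eqP->.
  - by case/JP=> /CP[].
have [H [sat sub ept earc]] := saturated_site_extension R place_inj r_site r_sub.
exists H; split=> //.
pose L : R := #|I|.+1%:R.
have L0 : 0 < L by rewrite ltr0n.
have noyI w : w \in I -> ~~ H w y.
  move=> wI; apply/negP => Hwy.
  (* The triangle [x c c']: the places of [I] on the axis are inside, and [y] lies to the left of
     the side [x c]. *)
  pose m := min3 (affine 0 1 0) (affine L (-1) (- L)) (affine L (-1) L) : R * R -> R.
  pose curve := [set [set x; c]; [set x; c']; [set c; c']]%SET.
  have rxc : r x c by rewrite /r !eqxx.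
  have rxc' : r x c' by rewrite /r !eqxx ?orbT.
  have rcc' : r c c' by rewrite /r !eqxx ?orbT.
  have cm : continuous m by apply: min3_continuous; exact: affine_continuous.
  have curve_H : curve \subset edges H.
    by apply/fintype.subsetP => e; rewrite !inE => /orP[/orP[]|] /eqP->; apply/edge_mem/sub.
  have cover z : m z = 0 -> exists2 e, e \in curve & pg_arc H e z.
    move=> mz; have [h1 h2 h3 h] := min3_eq0 mz; move: h1 h2 h3 h; rewrite /affine => h1 h2 h3.
    have y1 : 0 <= 1 - z.2 by nra.
    have y2 : 0 <= 1 + z.2 by nra.
    case=> h4.
    + exists [set x; c]%SET; first by rewrite !inE eqxx.
      by rewrite earc // place_x place_c; apply: segment_top_bot; lra.
    + exists [set x; c']%SET; first by rewrite !inE eqxx ?orbT.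
      rewrite earc // place_x place_c'; apply: segment_top_axis; rewrite -/L; first by lra.
      by nra.
    + exists [set c; c']%SET; first by rewrite !inE eqxx ?orbT.
      rewrite earc // place_c place_c'; apply: segment_bot_axis; rewrite -/L; first by lra.
      by nra.
  have mw : 0 < m (pg_pt H w).
    have [i iI ei] := place_I _ wI; rewrite ept ei min3_gt0 /affine /=.
    have i0 : 0 < i.+1%:R :> R by rewrite ltr0n.
    have iL : i.+1%:R < L by rewrite ltr_nat ltnS.
    by lra.
  have my : m (pg_pt H y) <= 0.
    by rewrite ept place_y leNgt min3_gt0 /affine /=; lra.
  have [e] := separation cm curve_H cover Hwy mw my.
  have [wC wc wc'] := IP _ wI; have /andP[wx wy] := neC _ wC.
  have /andP[h1 h2] := neC _ cinC; have /andP[h3 h4] := neC _ c'inC.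
  by rewrite !inE => /orP[/orP[]|] /eqP->; rewrite !inE ?(negbTE wx) ?(negbTE wc) ?(negbTE wc')
    ?(negbTE yx) ?[y == c]eq_sym ?[y == c']eq_sym ?(negbTE h2) ?(negbTE h4).
have [_ [f f_inj fG] _] := sat.
have sH := adj_sym H; have iH := adj_irr H; have eH := double_num_edges H.
have dHx : (4 * k + 3 <= deg H x)%N.
  rewrite -cI; apply: subset_leq_card; apply/fintype.subsetP => v vI; rewrite inE sub //.
  by rewrite /r eqxx vI !orbT.
have dHy : (4 * k + 3 <= deg H y)%N.
  apply: leq_trans cJ _; apply: subset_leq_card; apply/fintype.subsetP => v vJ; rewrite inE sub //.
  by rewrite /r eqxx vJ !orbT.
have hub v : (4 * k + 3 <= deg H v)%N -> (f v == x) || (f v == y).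
  move=> dv; apply: contraT; rewrite negb_or => /andP[vx vy].
  have := deg_hom f_inj (E := H) (E' := G) (fG v); have := small _ vx vy.
  by clear -dv; lia.
have nothub v : v != x -> v != y -> (f v != x) && (f v != y).
  move=> vx vy; rewrite -negb_or; apply/negP => fv.
  have := hub _ dHx; have := hub _ dHy; move: fv.
  have inj2 a b z : a != b -> f a = z -> f b = z -> False.
    by move=> ab e1 e2; case/negP: ab; rewrite -(inj_eq f_inj) e1 e2.
  by move=> /orP[]/eqP e1 /orP[]/eqP e2 /orP[]/eqP e3;
    first [exact: inj2 vx e1 e3|exact: inj2 vy e1 e2|exact: inj2 yx e2 e3].
have le_del : (arcs (del_vertex x (del_vertex y H)) <= arcs (del_vertex x (del_vertex y G)))%N.
  apply: (arcs_hom f_inj) => u v /and3P[ux vx /and3P[uy vy /fG Guv]].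
  by have /andP[h1 h2] := nothub _ ux uy; have /andP[h3 h4] := nothub _ vx vy;
    rewrite /del_vertex h1 h2 h3 h4.
have H1 := arcs_del_vertex y sH iH; have G1 := arcs_del_vertex y sG iG.
have H2 := arcs_del_vertex x (del_vertex_sym y sH) (del_vertex_irr y iH).
have G2 := arcs_del_vertex x (del_vertex_sym y sG) (del_vertex_irr y iG).
have dH : (deg (del_vertex y H) x <= d)%N.
  apply: leq_trans (maxd (f x)); apply: (deg_hom f_inj) => v /and3P[_ _]; exact: fG.
have dG : (d <= deg (del_vertex y G) x + 1)%N.
  rewrite -dx -(cards1 y) addnC; apply: leq_trans (leq_card_setU _ _); apply: subset_leq_card.
  apply/fintype.subsetP => v; rewrite !inE /del_vertex eq_sym => ->.
  by case: eqVneq => //= _; rewrite eq_sym yx.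
have degH : (deg H y + (4 * k + 3) < n)%N.
  have yI : y \notin I by apply/negP => /IP[/neC]; rewrite eqxx andbF.
  have := cardsC (y |: I); rewrite cardsU1 yI cI -/n /= => <-.
  rewrite addnC add1n ltnS leq_add2l; apply: subset_leq_card.
  apply/fintype.subsetP => v; rewrite inE => Hyv; rewrite finset.in_setC finset.in_setU1 negb_or.
  apply/andP; split; first by apply: contraTneq Hyv => ->; rewrite iH.
  by apply: contraTN Hyv => /noyI; rewrite sH.
(* Against the [4k + 4] vertices not adjacent to [y] in [H], itself included, stand the deficit of
   at most [2k] in the degree of [y] in [G], the difference [n - d <= k], and 1 for a possible edge
   [x y]. *)
clear -H1 H2 G1 G2 dH dG degH le_del eH eG Gub dy nd; lia.
Qed.
End TwoHubCase.

(** * Sectors around a hub *)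

(** With [Bot] in position 0, the segment from [Top] to position [i] satisfies [z.1 = i * (1 - z.2)]
    for every [i]. *)
Definition ray (i : nat) : site := if i is j.+1 then Axis j else Bot.

Definition next (d i : nat) : nat := if i.+1 == d then 0%N else i.+1.

(** The last sector, from the last position back to [Bot], is the unbounded one. *)
Definition sector_site (d i : nat) : site := if i.+1 == d then FarAxis 0 else Wedge i.

Lemma next_lt d i : (i < d)%N -> (next d i < d)%N.
Proof. by rewrite /next; case: eqP; lia. Qed.

Section WheelGeometry.
Variable R : realType.

Lemma natrS (k : nat) : k.+1%:R = k%:R + 1 :> R.
Proof. by rewrite -addn1 natrD. Qed.

(** A sector is a triangle with corner [Top], except that the last one is the complement of such a
    triangle, whence the reversed sign. For [i = 0] the third side runs from [Bot] to the axis
    instead of along the axis. *)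
Lemma sector_function d i : (3 <= d)%N -> (i < d)%N ->
  exists m : R * R -> R,
    [/\ continuous m, 0 < m (coord R (sector_site d i)),
      forall p, [\/ p = Top, exists2 k, (k < d)%N & p = ray k,
                 exists2 j, (j < d)%N && (j != i) & p = sector_site d j |
                 exists k, p = Low k] -> m (coord R p) <= 0 &
      forall z, m z = 0 -> [\/ segment (coord R Top) (coord R (ray i)) z,
        segment (coord R Top) (coord R (ray (next d i))) z |
        segment (coord R (ray i)) (coord R (ray (next d i))) z]].
Proof.
move=> d3 id.
have P k : 0 < k.+1%:R :> R by rewrite ltr0n.
have [e|ne] := eqVneq i.+1 d.
  rewrite /next /sector_site e eqxx /=.
  case: i e id => [|i] e id; first by lia.
  pose L : R := i.+1%:R.
  have L2 : 2 <= L by rewrite ler_nat; lia.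
  exists (fun z => - min3 (affine 0 1 0) (affine L (-1) (- L)) (affine L (-1) L) z); split.
  - by move=> z; apply: cvgN; apply: min3_continuous; exact: affine_continuous.
  - by rewrite oppr_gt0 ltNge min3_ge0 /affine /=; lra.
  - move=> p h; rewrite oppr_le0 min3_ge0 /affine.
    case: h => [->|[[|k] kd ->]|[j /andP[jd ji] ->]|[k ->]] /=.
    + by lra.
    + by lra.
    + have : k.+1%:R <= L by rewrite ler_nat; lia.
      by move: (P k); lra.
    + rewrite /sector_site ifN /=; last by lia.
      have : (2 * j + 1)%:R <= 2 * L by rewrite -natrM ler_nat; lia.
      have : 0 <= (2 * j + 1)%:R :> R by [].
      by lra.
    + by move: (low_bounds R k); set q := _^-1; lra.
  - move=> z /eqP; rewrite oppr_eq0 => /eqP mz.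
    have [h1 h2 h3 h] := min3_eq0 mz; move: h1 h2 h3 h; rewrite /affine => h1 h2 h3.
    have y1 : 0 <= 1 - z.2 by nra.
    have y2 : 0 <= 1 + z.2 by nra.
    case=> h4.
    + by apply: Or32; apply: segment_top_bot; lra.
    + by apply: Or31; apply: segment_top_axis; rewrite -/L; [lra|nra].
    + by apply: Or33; rewrite segment_sym; apply: segment_bot_axis; rewrite -/L; [lra|nra].
rewrite /next /sector_site (negbTE ne) /=.
have id' : (i.+1 < d)%N by lia.
pose c : R := i%:R.
have c0 : 0 <= c by [].
have cS : i.+1%:R = c + 1 by rewrite natrS.
exists (min3 (affine (- c) 1 c) (affine (c + 1) (-1) (- (c + 1)))
  (if i == 0%N then affine 1 (-1) 1 else affine 0 0 1)); split.
- by apply: min3_continuous; [exact: affine_continuous|exact: affine_continuous|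
    case: ifP => _; exact: affine_continuous].
- rewrite min3_gt0 /affine /= natrD natrM -/c.
  case: eqP => [i0|_]; rewrite /c ?i0 /=; lra.
- move=> p h; rewrite leNgt min3_gt0 /affine; apply/negP.
  case: (posnP i) => [i0|ip]; last first.
    have c1 : 1 <= c by rewrite ler1n.
    case: h => [->|[[|k] kd ->]|[j /andP[jd ji] ->]|[k ->]] /=.
    + by lra.
    + by lra.
    + by lra.
    + rewrite /sector_site; case: eqP => [_|_] /=; first by move: (P 1%N); lra.
      rewrite natrD natrM; have [ji'|ij|e] := ltngtP j i; last by rewrite e eqxx in ji.
        have := nat_gap R ji'; rewrite -/c; lra.
      have := nat_gap R ij; rewrite -/c; lra.
    + by move: (low_bounds R k); set q := _^-1; lra.
  have cz : c = 0 by rewrite /c i0.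
  case: h => [->|[[|k] kd ->]|[j /andP[jd ji] ->]|[k ->]] /=; rewrite ?cz.
  + by lra.
  + by lra.
  + have : 0 <= k%:R :> R by [].
    by rewrite natrS; lra.
  + rewrite /sector_site; case: eqP => [_|_] /=; first by move: (P 1%N); lra.
    have j1 : 1 <= j%:R :> R by rewrite ler1n lt0n -i0.
    by rewrite natrD natrM; lra.
  + by move: (low_bounds R k); set q := _^-1; lra.
- move=> z mz; have [h1 h2 h3 h] := min3_eq0 mz; move: h1 h2 h3 h; rewrite /affine.
  case: i id ne id' @c c0 cS mz => [|i] id ne id' c c0 cS mz /= h1 h2 h3.
    have cz : c = 0 by [].
    move: h1 h2; rewrite cz => h1 h2; case=> h4.
    + by apply: Or31; apply: segment_top_bot; lra.
    + by apply: Or32; apply: segment_top_axis; lra.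
    + by apply: Or33; apply: segment_bot_axis; lra.
  have c1 : 1 <= c by rewrite ler1n.
  have y1 : 0 <= 1 - z.2 by nra.
  case=> h4.
  + by apply: Or31; apply: segment_top_axis; rewrite -/c; lra.
  + by apply: Or32; apply: segment_top_axis; rewrite ?cS; lra.
  + have z2 : z.2 = 0 by lra.
    by apply: Or33; apply: segment_axis; rewrite ?z2 // ?cS -?/c; move: h1 h2; rewrite z2; lra.
Qed.

Lemma chained_sym (K : set (R * R)) p q : chained K p q -> chained K q p.
Proof.
move=> h e e0; have [s [ps ls ins]] := h e e0.
exists (rev (belast p s)); split.
- by rewrite -ls rev_path; apply: sub_path ps => a b; rewrite closeC.
- by case: s {ps ins} ls => [<- //|a s _] /=; rewrite rev_cons last_rcons.
- move=> z zs; apply: ins; rewrite lastI mem_rcons inE ls.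
  by move: zs; rewrite inE mem_rev.
Qed.

Lemma segment_compact_chained (a b : R * R) :
  compact (segment a b) /\ chained (segment a b) a b.
Proof.
have [->|ab] := eqVneq a b; last first.
  by split; [exact: arc_compact (segment_arc ab)|exact: arc_chained (segment_arc ab)].
have -> : segment b b = [set b].
  apply/seteqP; split=> z; first by case=> t _ ->; rewrite !subrr !mulr0 !addr0 -surjective_pairing.
  by move->; exists 0; rewrite ?lexx ?ler01 // !mul0r !addr0 -surjective_pairing.
split; first exact: compact_set1.
by move=> e e0; exists [::]; split=> // z; rewrite inE => /eqP.
Qed.

Lemma ray_equation j z : segment (coord R Top) (coord R (ray j)) z ->
  z.1 = j%:R * (1 - z.2) /\ z.2 <= 1.
Proof.
case: j => [|j] [t t01 ->] /=; first by split; lra.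
by split; [ring|lra].
Qed.

Lemma horizontal_segment (a b c : R) z : a <= b -> segment (a, c) (b, c) z ->
  z.2 = c /\ a <= z.1 <= b.
Proof. by move=> ab [t t01 ->] /=; split; [ring|nra]. Qed.

Lemma vertical_segment (a b c : R) z : a <= b -> segment (c, a) (c, b) z ->
  z.1 = c /\ a <= z.2 <= b.
Proof. by move=> ab [t t01 ->] /=; split; [ring|nra]. Qed.

Lemma chain_union (K L : set (R * R)) p q a : compact K /\ chained K p q ->
  compact L /\ chained L q a -> compact (K `|` L) /\ chained (K `|` L) p a.
Proof.
move=> [cK hK] [cL hL]; split; first exact: compactU.
apply: (chained_trans (q := q)).
  by apply: (chained_sub _ hK) => z; left.
by apply: (chained_sub _ hL) => z; right.
Qed.

(** * Detours close to the hub *)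

Section Detour.
Variables (d : nat) (e : R).
Hypotheses (d3 : (3 <= d)%N) (e0 : 0 < e) (e1 : e < 1).

Definition near_top i : R * R := (i%:R * e, 1 - e).

Definition stub i := segment (near_top i) (coord R (ray i)).

(* Around the last sector the hub has to be bypassed on its upper side. *)
Definition bypass i : set (R * R) :=
  if i.+1 == d then
    segment (i%:R * e, 1 - e) (i%:R * e, 1 + e) `|` segment (i%:R * e, 1 + e) (- e, 1 + e) `|`
    segment (- e, 1 + e) (- e, 1 - e) `|` segment (- e, 1 - e) (0, 1 - e)
  else segment (near_top i) (near_top i.+1).

(** The path follows one spoke almost to the hub, passes over to the next spoke and returns along
    it. The overlap with these two spokes is allowed in a weak drawing, since each shares an
    endpoint with the new edge. *)
Definition detour i := stub i `|` bypass i `|` stub (next d i).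

Lemma stub_segment i : stub i `<=` segment (coord R Top) (coord R (ray i)).
Proof.
have [pe pe1] := (e0, e1).
have mid (c t : R) : 0 <= c <= 1 -> 0 <= t -> t <= 1 -> 0 <= c + t * (1 - c) <= 1.
  move=> c01 t0 t1; have h1 : 0 <= t * (1 - c) by rewrite mulr_ge0 //; lra.
  have h2 : t * (1 - c) <= 1 * (1 - c) by rewrite ler_wpM2r //; lra.
  by lra.
case: i => [|i] z [t /andP[t0 t1] ->].
  exists (e / 2 + t * (1 - e / 2)); first by apply: mid => //; lra.
  by congr pair => /=; field.
exists (e + t * (1 - e)); first by apply: mid => //; lra.
by congr pair => /=; ring.
Qed.

Lemma stub_below i z : stub i z -> z.2 < 1.
Proof. by have [pe pe1] := (e0, e1); case: i => [|i] [t t01 ->] /=; nra. Qed.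

Lemma bypassP i z : (i < d)%N -> bypass i z ->
  [\/ [/\ i.+1 != d, z.2 = 1 - e & i%:R * e <= z.1 <= i.+1%:R * e] ,
      [/\ i.+1 = d, z.1 = i%:R * e & 1 - e <= z.2 <= 1 + e] |
      i.+1 = d /\ [\/ z.2 = 1 + e /\ - e <= z.1 <= i%:R * e,
        z.1 = - e /\ 1 - e <= z.2 <= 1 + e | z.2 = 1 - e /\ - e <= z.1 <= 0]].
Proof.
have [pe pe1] := (e0, e1).
move=> id; have ie : 0 <= i%:R * e by rewrite mulr_ge0 // ltW.
rewrite /bypass; case: eqP => [ed|/eqP ne]; last first.
  case/horizontal_segment => [|h1 h2]; last by apply: Or31; split.
  by rewrite ler_wpM2r ?ler_nat // ltW.
case=> [[[|]|]|].
- by case/vertical_segment => [|h1 h2]; [lra|apply: Or32].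
- rewrite segment_sym => /horizontal_segment[|h1 h2]; first by lra.
  by apply: Or33; split=> //; apply: Or31.
- rewrite segment_sym => /vertical_segment[|h1 h2]; first by lra.
  by apply: Or33; split=> //; apply: Or32.
- case/horizontal_segment => [|h1 h2]; first by lra.
  by apply: Or33; split=> //; apply: Or33.
Qed.

Lemma bypass_close i z r : (i < d)%N -> d%:R * e < r -> bypass i z ->
  close r z (coord R Top).
Proof.
have [pe pe1] := (e0, e1).
move=> id der /(bypassP id) h.
have d1 : 3 <= d%:R :> R by rewrite ler_nat.
have de : e <= d%:R * e by nra.
have le : i.+1%:R * e <= d%:R * e by rewrite ler_wpM2r ?ler_nat // ltW.
have ie : 0 <= i%:R * e by rewrite mulr_ge0 // ltW.
rewrite natrS mulrDl mul1r in le; rewrite natrS mulrDl mul1r in h.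
rewrite /close /= subr0 !ltr_norml.
by case: h => [[_ h1 h2]|[_ h1 h2]|[_ [] [h1 h2]]]; apply/andP; split; apply/andP; split; lra.
Qed.

Lemma bypass_ray i j z : (i < d)%N -> (j < d)%N -> j != i -> j != next d i ->
  bypass i z -> segment (coord R Top) (coord R (ray j)) z -> False.
Proof.
have [pe pe1] := (e0, e1).
move=> id jd ji jn /(bypassP id) h /ray_equation[z1 z2].
have cancel (a b : nat) : a%:R * e <= b%:R * e -> (a <= b)%N.
  by rewrite ler_pM2r // ler_nat.
case: h => [[ne h1 /andP[h2 h3]]|[ed h1 h2]|[ed h]].
- rewrite z1 h1 opprB addrC subrK in h2 h3; move: jn; rewrite /next (negbTE ne).
  by have := cancel _ _ h2; have := cancel _ _ h3; lia.
- have ji' : (j < i)%N by move: ji; clear -jd ed; lia.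
  have := nat_gap R ji'; have : 0 <= j%:R :> R by [].
  by move: z1 z2 h1 h2; nra.
- move: jn; rewrite /next ed eqxx -lt0n => j0.
  have j1 : 1 <= j%:R :> R by rewrite ler1n.
  by case: h => [] [h1 h2]; nra.
Qed.

Lemma bypass_disjoint i j z : (i < d)%N -> (j < d)%N ->
  independent i (next d i) j (next d j) -> bypass i z -> bypass j z -> False.
Proof.
have [pe pe1] := (e0, e1).
wlog: i j / (i < j)%N.
  move=> W id jd ind bi bj; have [ij|ji|eij] := ltngtP i j.
  - exact: (W i j).
  - apply: (W j i) => //; case/and4P: ind => h1 h2 h3 h4.
    by apply/and4P; split; rewrite eq_sym.
  - by case/and4P: ind; rewrite eij eqxx.
move=> ij id jd /and4P[h1 h2 h3 h4] /(bypassP id) hi /(bypassP jd) hj.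
have ne : i.+1 != d by lia.
have [g1 g2] : z.2 = 1 - e /\ i%:R * e <= z.1 <= i.+1%:R * e.
  by case: hi => [[//]|[ed]|[ed]]; rewrite ed eqxx in ne.
have nxt : next d i = i.+1 by rewrite /next (negbTE ne).
have ij' : (i.+1 < j)%N by rewrite nxt in h2; clear -ij h2; lia.
have lt : i.+1%:R * e < j%:R * e by rewrite ltr_pM2r // ltr_nat.
have ie : 0 <= i%:R * e by rewrite mulr_ge0 // ltW.
case: hj => [[_ k1 k2]|[ed k1 k2]|[ed k]]; [by lra|by lra|].
have i0 : (0 < i)%N by rewrite lt0n eq_sym; move: h3; rewrite /next ed eqxx.
have : 0 < i%:R * e by rewrite mulr_gt0 // ltr0n.
by case: k => [] [k1 k2]; lra.
Qed.

Lemma detour_chained i : (i < d)%N -> compact (detour i) /\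
  chained (detour i) (coord R (ray i)) (coord R (ray (next d i))).
Proof.
have [pe pe1] := (e0, e1).
move=> id; apply: (chain_union _ (segment_compact_chained _ _)).
have stub_back : compact (stub i) /\ chained (stub i) (coord R (ray i)) (near_top i).
  by have [h1 h2] := segment_compact_chained (near_top i) (coord R (ray i)); split=> //;
    apply: chained_sym.
apply: (chain_union stub_back); rewrite /bypass /next; case: ifP => _; last first.
  exact: segment_compact_chained.
rewrite /near_top mul0r.
do 3![apply: (chain_union _ (segment_compact_chained _ _))].
exact: segment_compact_chained.
Qed.
End Detour.
End WheelGeometry.

(** * The wheel *)

Lemma ray_inj : injective ray.
Proof. by case=> [|i] [|j] // [->]. Qed.

Lemma sector_site_inj d i j : (i < d)%N -> (j < d)%N ->
  sector_site d i = sector_site d j -> i = j.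
Proof.
move=> id jd; rewrite /sector_site; case: eqP => h1; case: eqP => h2 //; last by case.
by move=> _; apply/eq_add_S; rewrite h1 h2.
Qed.

Section WheelCase.
Variables (R : realType) (V : finType) (G : sgraph V).

Definition filled (E : rel V) (x0 : V) d (s : seq V) : {set 'I_d} :=
  [set i : 'I_d | E (nth x0 s i) (nth x0 s (next d i))]%SET.

(** All vertices of degree [d] compete, not only [x0], because an embedding may move the hub to
    another vertex of the same degree. *)
Lemma optimal_listing x0 d : deg G x0 = d -> exists x (s : seq V),
  [/\ size s = d, uniq s, forall v, (v \in s) = G x v &
      forall x' s', size s' = d -> uniq s' -> (forall v, (v \in s') = G x' v) ->
        #|filled G x0 d s'| <= #|filled G x0 d s|]%N.
Proof.
move=> dx.
pose P (p : V * d.-tuple V) := uniq p.2 && [forall v, (v \in p.2) == G p.1 v].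
have s0 : size (enum [set v | G x0 v]%SET) == d by rewrite -cardE -dx.
have P0 : P (x0, Tuple s0).
  apply/andP; split; first exact: enum_uniq.
  by apply/forallP => v; rewrite mem_enum inE.
case: (arg_maxnP (fun p : V * d.-tuple V => #|filled G x0 d p.2|) P0) => -[x s] /= /andP[us /forallP sx] mx.
exists x, s; split=> //.
- exact: size_tuple.
- by move=> v; apply/eqP.
move=> x' s' /eqP ss us' sx'; apply: (mx (x', Tuple ss)).
by apply/andP; split=> //; apply/forallP => v; rewrite sx'.
Qed.

Section Place.
Variables (x : V) (d : nat) (s : seq V) (D : {set V}) (phi : V -> nat).

Definition wheel_place v : site :=
  if v == x then Top else if v \in s then ray (index v s) else
  if v \in D then sector_site d (phi v) else Low (index v (enum V)).

Hypothesis phi_lt : forall w, w \in D -> (phi w < d)%N.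
Hypothesis phi_inj : {in D &, injective phi}.

Lemma wheel_place_inj : injective wheel_place.
Proof.
have rT i : ray i <> Top by case: i.
have sT i : sector_site d i <> Top by rewrite /sector_site; case: ifP.
have rs i j : ray i <> sector_site d j by rewrite /sector_site; case: ifP; case: i.
have rL i j : ray i <> Low j by case: i.
have sL i j : sector_site d i <> Low j by rewrite /sector_site; case: ifP.
move=> u v; rewrite /wheel_place.
case: (eqVneq u x) => [->|_]; case: (eqVneq v x) => [->|_] //.
- by case: ifP => _; [move/esym/rT|case: ifP => _ // /esym/sT].
- by case: ifP => _; [move/rT|case: ifP => _ // /sT].
case: (boolP (u \in s)) => us; case: (boolP (v \in s)) => vs.
- by move/ray_inj; exact: index_injective.
- by case: ifP => _ e; [case: (rs _ _ e)|case: (rL _ _ e)].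
- by case: ifP => _ e; [case: (rs _ _ (esym e))|case: (rL _ _ (esym e))].
case: (boolP (u \in D)) => uD; case: (boolP (v \in D)) => vD.
- by move=> /(sector_site_inj (phi_lt uD) (phi_lt vD)); exact: phi_inj.
- by move/sL.
- by move=> /esym/sL.
- by case; apply: index_injective; rewrite mem_enum.
Qed.
End Place.

Lemma wheel_case x0 d : deg G x0 = d -> (forall v, deg G v <= d)%N -> (3 <= d)%N ->
  exists H : plane_graph R V, plane_saturated_subgraph H G /\
    (num_edges H + 6 + minn d (#|V| - d - 1) <= 3 * #|V|)%N.
Proof.
move=> dx0 maxd d3; set n := #|V|.
have sG := adj_sym G; have iG := adj_irr G.
have [x [s [sd us sx best]]] := optimal_listing dx0.
have d0 : (0 < d)%N by lia.
pose u i := nth x0 s i.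
have u_in i : (i < d)%N -> u i \in s by move=> id; rewrite mem_nth ?sd.
have idx i : (i < d)%N -> index (u i) s = i by move=> id; rewrite index_uniq ?sd.
have xs : x \notin s by rewrite sx iG.
pose Phi := filled G x0 d s.
pose M := (~: (x |: [set v in s]))%SET.
have cs : #|[set v in s]%SET| = d by rewrite cardsE (card_uniqP us) sd.
have cM : (#|M| + d + 1 = n)%N.
  by have := cardsC (x |: [set v in s])%SET; rewrite cardsU1 inE xs cs -/M -/n /=; lia.
pose h := minn #|Phi| #|M|.
have [D DM cD] := subset_of_card (geq_minr #|Phi| #|M|); rewrite -/h in cD.
have DP w : w \in D -> (w != x) && (w \notin s).
  by move=> /(fintype.subsetP DM); rewrite !inE negb_or.
(* The vertices of [D] are distributed injectively over the filled sectors; the default of [nth] is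
   never reached on [D]. *)
pose phi w : nat := nth (Ordinal d0) (enum Phi) (index w (enum D)).
have index_phi w : w \in D -> (index w (enum D) < size (enum Phi))%N.
  move=> wD; rewrite -cardE; apply: leq_trans (geq_minl #|Phi| #|M|).
  by rewrite -/h -cD cardE index_mem mem_enum.
have phi_Phi w : w \in D -> exists2 i : 'I_d, i \in Phi & phi w = i.
  by move=> wD; eexists; last reflexivity; rewrite -mem_enum mem_nth // index_phi.
have phi_lt w : w \in D -> (phi w < d)%N by move=> /phi_Phi[i _ ->].
have phi_inj : {in D &, injective phi}.
  move=> w w' wD w'D /ord_inj/eqP; rewrite nth_uniq ?index_phi ?enum_uniq // => /eqP.
  by apply: index_injective; rewrite mem_enum.
pose place := wheel_place x d s D phi.
have place_inj : injective place by exact: wheel_place_inj phi_lt phi_inj.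
have place_x : place x = Top by rewrite /place /wheel_place eqxx.
have neS v : v \in s -> v != x by apply: contraTneq => ->.
have place_s v : v \in s -> place v = ray (index v s).
  by move=> vs; rewrite /place /wheel_place (negbTE (neS _ vs)) vs.
have place_D w : w \in D -> place w = sector_site d (phi w).
  by move=> wD; have /andP[/negbTE h1 /negbTE h2] := DP _ wD; rewrite /place /wheel_place h1 h2 wD.
(* Spokes, rim edges between consecutive positions, and the closing rim edge; the latter is directed
   from position 0 because [site_edge] lists [Bot] first. *)
pose r a b := [|| (a == x) && (b \in s),
   [&& a \in s, b \in s, index b s == (index a s).+1 & G a b] |
   [&& a \in s, b \in s, index a s == 0%N, (index b s).+1 == d & G a b]].
have r_site a b : r a b -> site_edge (place a) (place b).
  case/or3P.
  - by case/andP=> /eqP-> bs; rewrite place_x place_s //; case: index.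
  - by case/and4P=> as_ bs /eqP e _; rewrite !place_s // e; case: index => //= i; rewrite eqxx.
  - case/and5P=> as_ bs /eqP e /eqP e' _; rewrite !place_s // e.
    by case: (index b s) e' => // e'; move: d3; rewrite -e'.
have r_sub a b : r a b -> G a b.
  case/or3P; last by case/and5P.
  - by case/andP=> /eqP->; rewrite sx.
  - by case/and4P.
have [H [sat sub ept earc]] := saturated_site_extension R place_inj r_site r_sub.
exists H; split=> //.
have [_ [f f_inj fG] _] := sat.
have sH := adj_sym H; have iH := adj_irr H; have eH := double_num_edges H.
have rx v : v \in s -> r x v by move=> vs; rewrite /r eqxx vs.
(* The drawn spokes already give [x] the degree [d], and no vertex of a subgraph of [G] has a larger
   one. *)
have sHx v : (v \in s) = H x v.
  have : [set v in s]%SET \subset [set v | H x v]%SET.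
    by apply/fintype.subsetP => w; rewrite !inE => /rx/sub.
  have le : (deg H x <= d)%N by apply: leq_trans (deg_hom f_inj (fG x)) (maxd _).
  move=> ss; have /eqP e : [set v in s]%SET == [set v | H x v]%SET.
    by rewrite eqEcard ss cs.
  by move/finset.setP/(_ v): e; rewrite !inE.
have ptE v : pg_pt H v = coord R (place v) by [].
have pt_x : pg_pt H x = coord R Top by rewrite ept place_x.
have pt_u i : (i < d)%N -> pg_pt H (u i) = coord R (ray i).
  by move=> id; rewrite ept place_s ?u_in // idx.
have H_spoke i : (i < d)%N -> H x (u i) by move=> id; rewrite -sHx u_in.
have arc_spoke i : (i < d)%N ->
    pg_arc H [set x; u i]%SET = segment (coord R Top) (coord R (ray i)).
  by move=> id; rewrite earc ?rx ?u_in // place_x place_s ?u_in // idx.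
have rim (i : 'I_d) : i \in Phi -> H (u i) (u (next d i)) /\
    pg_arc H [set u i; u (next d i)]%SET =
    segment (coord R (ray i)) (coord R (ray (next d i))).
  rewrite inE -/(u i) -/(u _) => Guu; have id := ltn_ord i; have nd := next_lt id.
  have [e|ne] := eqVneq i.+1 d.
    have n0 : next d i = 0%N by rewrite /next e eqxx.
    have ruu : r (u 0%N) (u i).
      apply/or3P; apply: Or33; rewrite !u_in // !idx // e !eqxx /=.
      by rewrite n0 in Guu; rewrite sG.
    rewrite n0; split; first by rewrite sH; apply: sub.
    by rewrite finset.setUC earc // !place_s ?u_in // !idx // segment_sym.
  have n1 : next d i = i.+1 by rewrite /next (negbTE ne).
  rewrite n1 in nd Guu *.
  have ruu : r (u i) (u i.+1) by apply/or3P; apply: Or32; rewrite !u_in // !idx // eqxx.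
  by split; [exact: sub|rewrite earc // !place_s ?u_in // !idx].
(* The embedding turns [s] into a listing of the neighbours of [f x]; one more filled pair would
   contradict the choice of [s]. *)
have gap_free (i : 'I_d) : i \notin Phi -> H (u i) (u (next d i)) = false.
  move=> iPhi; apply/negP => Huu.
  have := best (f x) (map f s); rewrite size_map sd (map_inj_uniq f_inj) us.
  have fs v : (v \in map f s) = G (f x) v.
    have imS : (f @: [set v in s] \subset [set v | G (f x) v])%SET.
      by apply/fintype.subsetP => w /imsetP[z]; rewrite !inE sHx => /fG ? ->.
    have /eqP e : (f @: [set v in s] == [set v | G (f x) v])%SET.
      by rewrite eqEcard imS card_imset // cs; exact: maxd.
    move/finset.setP/(_ v): e; rewrite inE => <-; apply/mapP/imsetP => -[z zs ->]; exists z => //.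
      by rewrite inE.
    by move: zs; rewrite inE.
  move=> /(_ erefl isT fs); rewrite leqNgt => /negP; apply.
  rewrite -/Phi (_ : #|Phi|.+1 = #|i |: Phi|); last by rewrite cardsU1 iPhi.
  apply: subset_leq_card; apply/fintype.subsetP => k; rewrite in_setU1 => kP.
  have kd := ltn_ord k; have nk := next_lt kd.
  rewrite inE !(nth_map x0) ?sd //; apply: fG.
  by case/orP: kP => [/eqP->//|/rim[]].
(* The sector boundary leaves only its three corners as neighbours, and [x] drops out because its
   neighbours are exactly the members of [s]. *)
have hidden w c : w \in D -> H w c -> c \in [set u (phi w); u (next d (phi w))]%SET.
  move=> wD Hwc; have [i iPhi ei] := phi_Phi _ wD; have id := ltn_ord i.
  have /andP[wx ws] := DP _ wD.
  have [m [cm mw mout mcov]] := sector_function R d3 id.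
  pose curve := [set [set x; u i]; [set x; u (next d i)]; [set u i; u (next d i)]]%SET.
  have nd := next_lt id.
  have curve_H : curve \subset edges H.
    apply/fintype.subsetP => e; rewrite !inE => /orP[/orP[]|] /eqP->; apply: edge_mem.
    - exact: H_spoke.
    - exact: H_spoke.
    - exact: (rim _ iPhi).1.
  have cover z : m z = 0 -> exists2 e, e \in curve & pg_arc H e z.
    move/mcov => [] hz.
    - by exists [set x; u i]%SET; rewrite ?arc_spoke // !inE eqxx.
    - by exists [set x; u (next d i)]%SET; rewrite ?arc_spoke // !inE eqxx ?orbT.
    - by exists [set u i; u (next d i)]%SET; rewrite ?(rim _ iPhi).2 // !inE eqxx ?orbT.
  have mw' : 0 < m (pg_pt H w) by rewrite ept place_D // ei.
  have mc : m (pg_pt H c) <= 0.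
    rewrite ept; apply: mout; have [->|cx] := eqVneq c x; first by apply: Or41.
    have [csi|cs'] := boolP (c \in s).
      by apply: Or42; exists (index c s); rewrite ?place_s // -sd index_mem.
    have [cinD|cnotD] := boolP (c \in D); last first.
      apply: Or44; exists (index c (enum V)).
      by rewrite /place /wheel_place (negbTE cx) (negbTE cs') (negbTE cnotD).
    apply: Or43; exists (phi c); last exact: place_D.
    rewrite phi_lt // -ei; apply: contraTneq Hwc => /(phi_inj _ _ cinD wD) ->.
    by rewrite iH.
  have [e] := separation cm curve_H cover Hwc mw' mc.
  have nws v : v \in s -> (w == v) = false by move=> vs; apply: contraNF ws => /eqP->.
  have cx : c != x by apply: contraNneq ws => cx; rewrite sHx sH -cx.
  rewrite ei !inE => /orP[/orP[]|] /eqP->; rewrite !inE ?(negbTE wx) ?(negbTE cx) ?nws ?u_in //=.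
  - by move=> ->.
  - by move=> ->; rewrite orbT.
have deg_hidden w : w \in D -> (deg H w <= 2)%N.
  move=> wD; apply: (@leq_trans #|[set u (phi w); u (next d (phi w))]%SET|).
    by apply: subset_leq_card; apply/fintype.subsetP => c; rewrite inE => /(hidden _ _ wD).
  by rewrite cards2; case: (_ != _).
pose gap a b := [exists i : 'I_d, [&& i \notin Phi, a == u i & b == u (next d i)]].
(* The unfilled rim pairs become virtual edges. They only have to fit into the weak drawing for the
   edge bound to apply to [E]. *)
pose E a b := [|| H a b, gap a b | gap b a].
have [ptI arcP vertP cross] := pg_drawing H.
have [del del0 delP] : exists2 del : R, 0 < del & forall ab : V * V,
    H ab.1 ab.2 -> x != ab.1 -> x != ab.2 ->
    forall z, pg_arc H [set ab.1; ab.2]%SET z -> ~~ close del z (coord R Top).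
  apply: common_radius => [[a b] e e' le_e ee Hab xa xb z hz|[a b] /=].
    apply: contra (le_e Hab xa xb z hz) => /andP[l1 l2].
    by apply/andP; split; [apply: lt_le_trans l1 ee|apply: lt_le_trans l2 ee].
  have [Hab|nH] := boolP (H a b); last by exists 1.
  have [xa|nxa] := boolP (x != a); last by exists 1.
  have [xb|nxb] := boolP (x != b); last by exists 1.
  have [|e e0 eP] := compact_separated (arc_compact (arcP _ _ Hab)) (@compact_set1 _ (coord R Top)).
    rewrite -subset0 => z [hz ez]; have {}ez : z = coord R Top := ez; rewrite ez -pt_x in hz.
    by have := vertP _ _ (edge_mem Hab) hz; rewrite !inE (negbTE xa) (negbTE xb).
  by exists e => // _ _ _ z hz; apply: eP.
(* This makes [(d + 1) * e] the minimum of [del] and 1, hence [e < 1] and [d * e < del]: detours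
   bypass the hub within the distance that edges not at the hub keep from it. *)
pose e : R := Num.min del 1 / d.+1%:R.
have dS0 : 0 < d.+1%:R :> R by rewrite ltr0n.
have mu0 : 0 < Num.min del 1 by rewrite lt_min del0 ltr01.
have e0 : 0 < e by rewrite divr_gt0.
have eE : d%:R * e + e = Num.min del 1 by rewrite -{2}[e]mul1r -mulrDl -natrS mulrC divfK // gt_eqF.
have de0 : 0 <= d%:R * e by rewrite mulr_ge0 // ltW.
have mu1 : Num.min del 1 <= 1 by rewrite ge_min lexx orbT.
have mud : Num.min del 1 <= del by rewrite ge_min lexx.
have e1 : e < 1.
  have : 0 < d%:R * e by rewrite mulr_gt0 // ltr0n.
  by clear -eE mu1; lra.
have ded : d%:R * e < del by clear -eE mud e0; lra.
(* A stub is part of a spoke, which other edges of [H] meet only at its ends; the end [Top] is not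
   on the stub. *)
have stub_arc i a b z : (i < d)%N -> H a b -> u i != a -> u i != b ->
    stub e i z -> pg_arc H [set a; b]%SET z -> False.
  move=> id Hab ia ib st az; have z1 := stub_below e0 e1 st.
  have xz : pg_arc H [set x; u i]%SET z by rewrite arc_spoke //; exact: (stub_segment e0 e1 st).
  have ne : [set a; b]%SET != [set x; u i]%SET.
    apply/eqP => /set2_inj[[_ eb]|[ea _]]; first by rewrite eb eqxx in ib.
    by rewrite ea eqxx in ia.
  have [w [wab wxu ez]] := cross _ _ (edge_mem Hab) (edge_mem (H_spoke _ id)) ne _ az xz.
  move: wxu; rewrite !inE => /orP[]/eqP ew.
    by move: z1; rewrite ez ew pt_x ltxx.
  by move: wab; rewrite ew !inE (negbTE ia) (negbTE ib).
have uK v : v \in s -> u (index v s) = v by move=> vs; rewrite /u nth_index.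
have idx_lt v : v \in s -> (index v s < d)%N by move=> vs; rewrite -sd index_mem.
have spoke_bypass i v z : (i < d)%N -> v \in s -> u i != v -> u (next d i) != v ->
    bypass d e i z -> pg_arc H [set x; v]%SET z -> False.
  move=> id vs iv nv by_; rewrite -(uK _ vs) arc_spoke ?idx_lt //.
  apply: (bypass_ray d3 e0 e1 id (idx_lt _ vs) _ _ by_).
    by apply: contraNneq iv => <-; rewrite uK.
  by apply: contraNneq nv => <-; rewrite uK.
have arc_detour i a b z : (i < d)%N -> H a b -> independent a b (u i) (u (next d i)) ->
    detour d e i z -> pg_arc H [set a; b]%SET z -> False.
  move=> id Hab /and4P[ia ib na nb] [[st|by_]|st] az.
  - exact: stub_arc st az.
  - have [xa|xa] := eqVneq x a.
      apply: (spoke_bypass i b z) => //; first by rewrite sHx xa.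
      by rewrite xa.
    have [xb|xb] := eqVneq x b.
      apply: (spoke_bypass i a z) => //; first by rewrite sHx xb sH.
      by rewrite xb finset.setUC.
    by have := delP (a, b) Hab xa xb z az; rewrite (bypass_close d3 e0 e1 id ded by_).
  - by apply: stub_arc st az => //; exact: next_lt.
have stub_det i j z : (i < d)%N -> (j < d)%N -> i != j -> i != next d j ->
    stub e i z -> detour d e j z -> False.
  move=> id jd ij inj st de.
  have nd := next_lt jd.
  have u_neq k l : (k < d)%N -> (l < d)%N -> k != l -> u k != u l.
    by move=> kd ld; apply: contraNneq => ukl; rewrite -(idx k) // ukl idx.
  have ux k : (k < d)%N -> u k != x by move=> kd; apply/neS/u_in.
  apply: (arc_detour j x (u i) z) => //; first exact: H_spoke.
    by apply/and4P; split; rewrite ?ux // u_neq // eq_sym.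
  by rewrite arc_spoke //; apply: stub_segment st.
have detour_detour i j z : (i < d)%N -> (j < d)%N ->
    independent i (next d i) j (next d j) -> detour d e i z -> detour d e j z -> False.
  move=> id jd ind de1 de2; case/and4P: (ind) => h1 h2 h3 h4.
  have ni := next_lt id; have nj := next_lt jd.
  case: (de1) => [[st|by1]|st].
  - by apply: (stub_det i j z) => //; rewrite eq_sym.
  - case: de2 => [[st|by2]|st].
    + by apply: (stub_det j i z).
    + exact: (bypass_disjoint d3 e0 e1 id jd ind by1 by2).
    + by apply: (stub_det (next d j) i z).
  - by apply: (stub_det (next d i) j z) => //; rewrite eq_sym.
pose K a b := if H a b then pg_arc H [set a; b]%SET else
  if gap a b then detour d e (index a s) else detour d e (index b s).
have gapP a b : gap a b -> [/\ a \in s, b \in s, b = u (next d (index a s)) & H a b = false].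
  case/existsP=> i /and3P[iPhi /eqP-> /eqP->]; have id := ltn_ord i; have nd := next_lt id.
  by rewrite !u_in // idx //; split=> //; exact: gap_free.
have Kcases a b : E a b -> (H a b /\ K a b = pg_arc H [set a; b]%SET) \/
    exists2 i, (i < d)%N & K a b = detour d e i /\
     ((a = u i /\ b = u (next d i)) \/ (b = u i /\ a = u (next d i))).
  rewrite /E /K; case: ifP => [|nH /=]; first by left.
  case: ifP => [/gapP[as_ bs eb _] _|_ /= /gapP[bs as_ ea _]]; right.
    by exists (index a s); rewrite ?idx_lt //; split=> //; left; rewrite uK.
  by exists (index b s); rewrite ?idx_lt //; split=> //; right; rewrite uK.
have wE : weakly_planar R E.
  exists (pg_pt H), K; split.
    move=> a b /Kcases[[Hab ->]|[i id [-> hi]]].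
      by have isarc := arcP _ _ Hab; split; [exact: arc_compact isarc|exact: arc_chained isarc].
    have [cK hK] := detour_chained e0 e1 id; split=> //.
    have nd := next_lt id.
    by case: hi => [[-> ->]|[-> ->]]; rewrite !pt_u //; apply: chained_sym.
  move=> a b a' b' Eab Eab' ind; rewrite -subset0 => z [].
  have u_neq k l : u k != u l -> k != l by apply: contraNneq => ->.
  have [[Hab ->]|[i id [-> hi]]] := Kcases _ _ Eab; have [[Hab' ->]|[j jd [-> hj]]] := Kcases _ _ Eab'.
  - move=> az az'; case/and4P: ind => h1 h2 h3 h4.
    have ne : [set a; b]%SET != [set a'; b']%SET.
      apply/eqP => /set2_inj[[ea _]|[ea _]]; first by rewrite ea eqxx in h1.
      by rewrite ea eqxx in h3.
    have [w [+ + _]] := cross _ _ (edge_mem Hab) (edge_mem Hab') ne _ az az'.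
    by rewrite !inE => /orP[]/eqP-> /orP[]/eqP ew; move: h1 h2 h3 h4; rewrite ew eqxx.
  - move=> az dz; apply: (arc_detour j a b z) => //.
    by case: hj => [[<- <-]|[<- <-]] //; case/and4P: ind => h1 h2 h3 h4; apply/and4P; split.
  - move=> dz az; apply: (arc_detour i a' b' z) => //.
    by case: hi => [[<- <-]|[<- <-]] //; case/and4P: ind => h1 h2 h3 h4; apply/and4P; split;
      rewrite eq_sym.
  - move=> d1 d2; apply: (detour_detour i j z) => //.
    case/and4P: ind => h1 h2 h3 h4.
    by case: hi hj => [[ea eb]|[ea eb]] [[ea' eb']|[ea' eb']]; subst a b a' b';
      apply/and4P; split; apply: u_neq.
have sE : symmetric E by move=> a b; rewrite /E sH [gap a b || _]orbC.
have iE : irreflexive E.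
  move=> a; rewrite /E iH orbb; apply/negbTE/negP => /gapP[as_ _ ea _].
  have := idx _ (next_lt (idx_lt _ as_)); rewrite -ea.
  by have := idx_lt _ as_; clear -d3; rewrite /next; case: eqP; lia.
(* A hidden vertex carries at most two edges, one less than the three per vertex in the edge bound.
   Applying the bound to the rest therefore saves [#|D|] edges. *)
pose U := (~: D)%SET.
have cU : (#|D| + #|U| = n)%N by rewrite cardsC.
have U3 : (3 <= #|U|)%N.
  have : (#|Phi| <= d)%N by rewrite -[d in leqRHS]card_ord; exact: max_card.
  have := geq_minr #|Phi| #|M|; rewrite -/h; clear -cU cD cM d3; lia.
have wU : weakly_planar R (induced U E) by apply: weakly_planar_sub wE; exact: induced_sub.
have bound := arcs_bound (induced_sym U sE) (induced_irr U iE) (@induced_supported V U E) wU U3.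
have hidden_arcs : (arcs H <= arcs (induced U H) + 4 * #|D|)%N.
  have degD : (\sum_(w in D) deg H w <= 2 * #|D|)%N.
    rewrite mulnC -sum_nat_const; apply: leq_sum => w; exact: deg_hidden.
  suff : (arcs H <= arcs (induced U H) + 2 * \sum_(w in D) deg H w)%N by clear -degD; lia.
  have sum1 : (\sum_(w in D) deg H w = \sum_a \sum_b (a \in D) * H a b)%N.
    rewrite [LHS]big_mkcond; apply: eq_bigr => a _; rewrite -big_distrr /= -degE.
    by case: (a \in D); rewrite ?mul1n ?mul0n.
  have sum2 : (\sum_(w in D) deg H w = \sum_a \sum_b (b \in D) * H a b)%N.
    by rewrite sum1 exchange_big; apply: eq_bigr => a _; apply: eq_bigr => b _; rewrite sH.
  rewrite mul2n -addnn {1}sum1 sum2 !arcsE -!big_split; apply: leq_sum => a _.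
  rewrite -!big_split; apply: leq_sum => b _ /=; rewrite /induced /U !finset.in_setC.
  by case: (a \in D); case: (b \in D); case: (H a b); rewrite //= ?mul0n ?mul1n.
have gap_arcs : (d - #|Phi| <= arcs gap)%N.
  rewrite arcs_card.
  have -> : (d - #|Phi| = #|~: Phi|)%N by have := cardsC Phi; rewrite card_ord; clear; lia.
  have inj : injective (fun i : 'I_d => (u i, u (next d i))).
    by move=> i k [uik _]; apply: ord_inj; rewrite -(idx i) // uik idx.
  rewrite -(card_imset _ inj); apply: subset_leq_card.
  apply/fintype.subsetP => p /imsetP[i]; rewrite finset.in_setC => iPhi ->; rewrite inE /=.
  by apply/existsP; exists i; rewrite iPhi !eqxx.
have virtual_arcs : (arcs (induced U H) + 2 * arcs gap <= arcs (induced U E))%N.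
  have gapC : arcs gap = (\sum_a \sum_b gap b a)%N by rewrite arcsE exchange_big.
  rewrite mul2n -addnn {2}gapC !arcsE -!big_split; apply: leq_sum => a _.
  rewrite -!big_split; apply: leq_sum => b _ /=; rewrite /induced /U !finset.in_setC /E.
  have sD v : v \in s -> v \notin D by apply: contraTN => /DP /andP[].
  have [gab|ngab] := boolP (gap a b).
    have [as_ bs eb nH] := gapP _ _ gab; rewrite nH (sD _ as_) (sD _ bs) /=.
    (* For [d >= 3] no index is its own second successor in the cyclic order, so no pair is a gap in
       both directions. *)
    have [gba|] := boolP (gap b a) => //; exfalso.
    have [_ _ ea _] := gapP _ _ gba.
    have := idx _ (next_lt (idx_lt _ as_)); rewrite -eb => e3.
    have := idx _ (next_lt (idx_lt _ bs)); rewrite -ea => e4.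
    have := idx_lt _ as_; have := idx_lt _ bs; move: e3 e4; clear -d3; rewrite /next.
    by move: (index a s) (index b s) => p q; do 2!case: eqP; lia.
  have [gba|ngba] := boolP (gap b a); last by rewrite /= !addn0 orbF.
  have [bs as_ _ nH] := gapP _ _ gba; rewrite sH nH (sD _ as_) (sD _ bs) /=.
  by [].
have : (#|Phi| <= d)%N by rewrite -[d in leqRHS]card_ord; exact: max_card.
move: bound hidden_arcs gap_arcs virtual_arcs eH cD cU cM; rewrite /h; clear; lia.
Qed.
End WheelCase.

(** * The theorem *)

Section SmallSaturated.
Variables (R : realType) (V : finType) (G : sgraph V) (x : V) (d : nat).
Hypotheses (dx : deg G x = d) (maxd : forall v, (deg G v <= d)%N).

(** Saturates the edgeless drawing. The degree count settles [d <= 2], where there is no wheel. *)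
Lemma saturated_exists : exists H : plane_graph R V, plane_saturated_subgraph H G /\
  (2 * num_edges H <= #|V| * d)%N.
Proof.
pose place v := Low (index v (enum V)).
have place_inj : injective place by move=> u v []; apply: index_injective; rewrite mem_enum.
have [||H [sat _ _ _]] := @saturated_site_extension R V G (fun _ _ => false) place place_inj.
- by [].
- by [].
exists H; split=> //; have [_ [f f_inj fG] _] := sat.
rewrite double_num_edges -sum_nat_const; apply: leq_sum => v _.
exact: leq_trans (deg_hom f_inj (E := H) (E' := G) (fG v)) (maxd (f v)).
Qed.

Lemma max_degree_saving : (3 <= #|V|)%N ->
  exists H : plane_graph R V, plane_saturated_subgraph H G /\
    (num_edges H + 6 + minn d (#|V| - d - 1) <= 3 * #|V|)%N.
Proof.
move=> V3; have [d3|d2] := leqP 3 d; first exact: wheel_case dx maxd d3.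
have [H [sat le]] := saturated_exists; exists H; split=> //.
by case: d d2 le => [|[|[|//]]] _; lia.
Qed.

(** For [k = 0] the first bound is always enough, so the size condition concerns positive [k]
    only. *)
Lemma linear_saving k : weakly_planar R G -> (3 <= #|V|)%N ->
  (k = 0 \/ 13 * k + 78 <= #|V|)%N -> (k <= d)%N ->
  exists H : plane_graph R V, plane_saturated_subgraph H G /\
    (num_edges H + 6 + k <= 3 * #|V|)%N.
Proof.
move=> wG V3 kn kd.
have [kz|kz] := leqP k (#|V| - d - 1).
  have [H [sat le]] := max_degree_saving V3; exists H; split=> //.
  have : (k <= minn d (#|V| - d - 1))%N by rewrite leq_min kd kz.
  by clear -le; lia.
have nd : (#|V| <= d + k)%N by lia.
have {}kn : (13 * k + 78 <= #|V|)%N by case: kn => [k0|//]; rewrite k0 in kz.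
have [few|many] := leqP (num_edges G + 6 + k) (3 * #|V|).
  have [H [sat _]] := saturated_exists; exists H; split=> //.
  by have [_ /subgraph_num_edges h _] := sat; lia.
have big : (3 * #|V| <= num_edges G + 5 + k)%N by lia.
have [/forallP second|] := boolP [forall v, (v != x) ==> (deg G v + 2 * k < d)%N].
  by apply: (hub_case dx) => // v; apply/implyP.
rewrite negb_forall => /existsP[y]; rewrite negb_imply -leqNgt => /andP[yx dy].
exact: (two_hub_case dx maxd yx dy).
Qed.
End SmallSaturated.

(** After clearing the denominator, the second inequality says that [12 d n (n - d)] is
    nonnegative. *)
Lemma saving_bounds (R : realType) (n d : nat) : (3 <= n)%N -> (d <= n)%N ->
  let S : R := d%:R ^+ 2 / (12 * n%:R ^+ 2 + d%:R * n%:R) * n%:R in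
  0 <= S /\ 13 * S <= d%:R.
Proof.
move=> n3 dn S; have n0 : 0 < n%:R :> R by rewrite ltr0n; lia.
have dn' : d%:R <= n%:R :> R by rewrite ler_nat.
have d0 : 0 <= d%:R :> R by [].
have den : 0 < 12 * n%:R ^+ 2 + d%:R * n%:R :> R.
  by rewrite ltr_wpDr ?mulr_ge0 ?mulr_gt0 ?exprn_gt0.
split; first by rewrite /S !mulr_ge0 ?invr_ge0 ?exprn_ge0 // ltW.
rewrite /S mulrAC mulrA ler_pdivrMr // -subr_ge0.
have -> : d%:R * (12 * n%:R ^+ 2 + d%:R * n%:R) - 13 * (d%:R ^+ 2 * n%:R) =
  12 * d%:R * n%:R * (n%:R - d%:R) :> R by ring.
by rewrite !mulr_ge0 // ?subr_ge0 // ltW.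
Qed.

Theorem theorem5 (R : realType) (V : finType) (G : sgraph V) (n d : nat)
    (card_V : #|V| = n) (n_ge3 : (3 <= n)%N)
    (G_max : maximal_planar R G) (deg_G : max_degree G = d) :
  (exists (W : finType) (H : plane_graph R W),
     plane_saturated_subgraph H G /\
     (num_edges H)%:Z <= 3 * n%:Z - 6 - Num.min d%:Z (n%:Z - d%:Z - 1)) /\
  ((75 <= n)%N -> (933 / 1000 : R) * n%:R <= d%:R ->
   exists (W : finType) (H : plane_graph R W),
     plane_saturated_subgraph H G /\
     (num_edges H)%:R <=
       (3 - d%:R ^+ 2 / (12 * n%:R ^+ 2 + d%:R * n%:R)) * n%:R + 1 :> R).
Proof.
have V0 : (0 < #|V|)%N by rewrite card_V; lia.
have [x dx] := bigop.eq_bigmax (degree G) V0.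
have {}dx : deg G x = d by rewrite -deg_G /max_degree dx.
have maxd v : (deg G v <= d)%N by rewrite -deg_G; exact: (bigop.leq_bigmax v).
have dn : (d < n)%N by rewrite -dx -card_V; apply: deg_lt_card; exact: adj_irr.
have V3 : (3 <= #|V|)%N by rewrite card_V.
have [[pt [arc dr]] _] := G_max; have wG := plane_weakly_planar dr.
split.
  have [H [sat le]] := max_degree_saving R dx maxd V3.
  exists V, H; split=> //; rewrite card_V in le.
  have -> : Num.min d%:Z (n%:Z - d%:Z - 1) = (minn d (n - d - 1))%:Z.
    by rewrite minEle; case: leP; lia.
  by lia.
move=> _ _.
have [S0 S13] := saving_bounds R n_ge3 (ltnW dn).
set S : R := _ * n%:R in S0 S13.
pose t := Num.truncn S.
have [tS St] : t%:R <= S /\ S < t.+1%:R by have := truncn_itv S0; move/andP.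
have td : (13 * t <= d)%N.
  by rewrite -(ler_nat R) natrM; apply: le_trans S13; rewrite ler_wpM2l.
(* For [t >= 6], taking [k = t - 6] turns [3n - 6 - k] into [3n - t], and [13k + 78 = 13t <= d < n].
   For smaller [t] the truncated difference is 0. Rounding [S] down to [t] costs less than 1, which
   is the final summand of the bound. *)
have [||H [sat le]] := @linear_saving R V G x d dx maxd (t - 6) wG V3.
- by rewrite card_V; lia.
- by lia.
exists V, H; split=> //; rewrite card_V in le.
rewrite mulrBl -/S.
have : (num_edges H + t <= 3 * n)%N by lia.
rewrite -(ler_nat R) natrD natrM; move: St; rewrite natrS; lra.
Qed.
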